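(* Let $n\ge2$ and $\lambda,\mathcal{K}>0$, let $\Omega\subset\mathbb{R}^n$ be a $c_0$-uniform domain with center $x_0$, let $f\in\mathcal{F}_{\lambda,\mathcal{K}}(\Omega)$, and let $h$ be a doubling gauge function satisfying $$\int_0\big(h(t)\log(1/t)\big)^{1/(n-1)}\,\frac{dt}{t}<\infty.$$ Then $f$ has a unique limit along curves $\gamma\in I(\xi,x_0)$ for $\mathcal{H}^h$-a.e. $\xi\in\partial\Omega$; i.e., for $\mathcal{H}^h$-a.e. $\xi\in\partial\Omega$, if $\gamma,\eta\in I(\xi,x_0)$ are such that $$\lim_{t\to0^+}f(\gamma(t))=a\quad\text{and}\quad\lim_{t\to0^+}f(\eta(t))=b,$$ then $a=b$.
   Context: **Mappings.** A mapping $f:\Omega\to\mathbb{R}^n$ has finite distortion if (a) $f\in W^{1,1}_{\rm loc}(\Omega,\mathbb{R}^n)$, (b) $J_f=\det(Df)\in L^1_{\rm loc}(\Omega)$, and (c) there is a measurable $K_f:\Omega\to[1,\infty)$ with $|Df(x)|^n\le K_f(x)J_f(x)$ for a.e. $x\in\Omega$ (operator norm). $\mathcal{F}_{\lambda,\mathcal{K}}(\Omega)$ is the class of mappings of finite distortion $f:\Omega\to\mathbb{R}^n$ with $f(x_0)=0$, $\int_\Omega J_f\,dx\le|\Omega|$ and $\int_\Omega\exp(\lambda K_f)\,dx\le\mathcal{K}$; such mappings are identified with their continuous representatives. **Domains.** A $c$-John curve joining $x$ to $x_0$ in $\Omega$ is a rectifiable curve $\gamma:[0,l]\to\Omega$ parametrized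 by arc length with $\gamma(0)=x$, $\gamma(l)=x_0$ and $d(\gamma(t),\partial\Omega)\ge t/c$ for all $t\in[0,l]$. A bounded domain $\Omega$ is a $c$-John domain with center $x_0$ if every $x\in\Omega$ can be joined to $x_0$ by a $c$-John curve. For $\xi\in\partial\Omega$, a $c$-John curve connecting $\xi$ to $x_0$ is defined in the same way, with $\gamma(0)=\xi$ and $\gamma((0,l])\subset\Omega$; $I(\xi,x_0)$ is the collection of all $c_0$-John curves connecting $\xi$ to $x_0$. A bounded domain $\Omega$ is a uniform domain if there is a constant $c'>0$ such that each pair $x_1,x_2\in\Omega$ can be joined by a curve $\gamma$ in $\Omega$ with length $l(\gamma)\le c'|x_1-x_2|$ and $\min_{i=1,2}l(\gamma(x_i,x))\le c'\,d(x,\partial\Omega)$ for all $x\in\gamma$, where $\gamma(x_i,x)$ is the part of $\gamma$ between $x_i$ and $x$. ''$\Omega$ is a $c_0$-uniform domain with center $x_0$'' means: $\Omega$ is a uniform domain and it is a $c_0$-John domain with center $x_0$. **Gauges.** A gauge function is a nondecreasing continuous function $h$, defined for (small) $t\ge0$, with $h(0)=0$ and $h(t)>0$ for $t>0$; it is doubling if $h(2t)\le D\,h(t)$ for some constant $D$ and all small $t>0$. $\mathcal{H}^h$ is the Hausdorff measure with gauge $h$. The notation $\int_0$ means that the integral over $(0,\varepsilon)$ is finite for some small $\varepsilon>0$. *)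

(* Defs.v *)
From HB Require Import structures.
From mathcomp Require Import all_boot all_order all_algebra.
From mathcomp Require Import all_classical all_reals all_analysis.

Set Implicit Arguments.
Unset Strict Implicit.
Unset Printing Implicit Defensive.
Import Order.TTheory GRing.Theory Num.Theory.
Import numFieldNormedType.Exports.

Local Open Scope classical_set_scope.
Local Open Scope ring_scope.

Definition rV_display : measure_display -> measure_display.
Proof. exact. Qed.

(* The sigma-algebra generated by the coordinates, i.e. the Borel one; same
   construction as the library's for n.-tuple T. *)
Section measurable_rV.
Context {R : realType} {n : nat}.

Let coord (i : 'I_n) (x : 'rV[R]_n) : R := x ord0 i.

Let rV_set0 : g_sigma_preimage coord set0.
Proof. exact: sigma_algebra0. Qed.

Let rV_setC A : g_sigma_preimage coord A -> g_sigma_preimage coord (~` A).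
Proof. exact: sigma_algebraC. Qed.

Let rV_bigcup (F : (set 'rV[R]_n)^nat) :
  (forall i, g_sigma_preimage coord (F i)) ->
  g_sigma_preimage coord (\bigcup_i (F i)).
Proof. exact: sigma_algebra_bigcup. Qed.

HB.instance Definition _ :=
  @isMeasurable.Build (rV_display default_measure_display)
    'rV[R]_n (g_sigma_preimage coord) rV_set0 rV_setC rV_bigcup.

End measurable_rV.

Section measurable_rV_lemmas.
Context {R : realType}.

Lemma measurable_coord n (i : 'I_n) :
  measurable_fun [set: 'rV[R]_n] (fun x : 'rV[R]_n => x ord0 i).
Proof.
move=> _ Y mY; rewrite setTI; apply: sub_sigma_algebra => /=.
rewrite -bigcup_seq/=; exists i => /=; first by rewrite mem_index_enum.
by exists Y => //; rewrite setTI.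
Qed.

Lemma measurable_fun_rV d (T : measurableType d) n (f : T -> 'rV[R]_n) :
  (forall i, measurable_fun [set: T] (fun x => f x ord0 i)) ->
  measurable_fun [set: T] f.
Proof.
move=> mf _ A mA; rewrite setTI.
suff sub : g_sigma_preimage (fun i (x : 'rV[R]_n) => x ord0 i) `<=`
    [set B | measurable (f @^-1` B)] by exact: sub.
apply: smallest_sub.
  split=> [|B /= mB|F /= mF].
  - by rewrite /= preimage_set0.
  - by rewrite setTD preimage_setC; exact: measurableC.
  - by rewrite preimage_bigcup; exact: bigcupT_measurable.
rewrite -bigcup_seq => B [i _ [Y mY <-]] /=.
by rewrite setTI -comp_preimage -[X in measurable X]setTI; exact: mf.
Qed.

Definition cons_rV n (p : measurableTypeR R * 'rV[R]_n) : 'rV[R]_n.+1 :=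
  row_mx (const_mx p.1 : 'rV[R]_1) p.2.

Lemma cons_rVl n (p : measurableTypeR R * 'rV[R]_n) (j : 'I_1) :
  cons_rV p ord0 (lshift n j) = p.1.
Proof. exact: etrans (row_mxEl _ _ _ _) (mxE _ _ _ _). Qed.

Lemma cons_rVr n (p : measurableTypeR R * 'rV[R]_n) (j : 'I_n) :
  cons_rV p ord0 (rshift 1 j) = p.2 ord0 j.
Proof. exact: row_mxEr. Qed.

Lemma measurable_cons_rV n : measurable_fun setT (@cons_rV n).
Proof.
apply: measurable_fun_rV => i.
case: (@split_ordP 1 n i) => j ->.
  by under eq_fun do rewrite cons_rVl; exact: measurable_fst.
under eq_fun do rewrite cons_rVr.
by apply: (measurableT_comp (measurable_coord j)); exact: measurable_snd.
Qed.

End measurable_rV_lemmas.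

Section lebesgue_rV_step.
Context {R : realType} (n : nat).
Variable m : {sigma_finite_measure set 'rV[R]_n -> \bar R}.

Definition lebesgue_step : set 'rV[R]_n.+1 -> \bar R :=
  pushforward (lebesgue_measure \x m)%E (@cons_rV R n).

Let mcons := @measurable_cons_rV R n.

Let step0 : lebesgue_step set0 = 0%E.
Proof. by rewrite /lebesgue_step /pushforward preimage_set0 measure0. Qed.

Let step_ge0 A : (0 <= lebesgue_step A)%E.
Proof. exact: measure_ge0. Qed.

Let step_sigma_additive : semi_sigma_additive lebesgue_step.
Proof.
move=> F mF tF mUF; rewrite /lebesgue_step /pushforward preimage_bigcup.
apply: measure_semi_sigma_additive.
- by move=> k; rewrite -[X in measurable X]setTI; exact: mcons.
- apply/trivIsetP => /= i j _ _ ij; rewrite -preimage_setI.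
  by move/trivIsetP : tF => /(_ _ _ _ _ ij) ->//; rewrite preimage_set0.
- by rewrite -preimage_bigcup -[X in measurable X]setTI; exact: mcons.
Qed.

HB.instance Definition _ := isMeasure.Build _ _ _ lebesgue_step
  step0 step_ge0 step_sigma_additive.

Let step_sigma_finite : sigma_finite setT lebesgue_step.
Proof.
have [F UF Foo] : sigma_finite setT (@lebesgue_measure R \x m)%E.
  have /sigma_finiteP[A [TA ndA Aoo]] := sigma_finiteT (@lebesgue_measure R).
  have /sigma_finiteP[B [TB ndB Boo]] := sigma_finiteT m.
  exists (fun k => A k `*` B k).
    rewrite -setXTT TA TB predeqE => -[x y]; split; last first.
      by move=> [k _ []/= ? ?]; split; exists k.
    move=> [/= [i _ Aix] [j _ Bjy]]; exists (maxn i j) => //; split.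
      by move: x Aix; exact/subsetPset/ndA/leq_maxl.
    by move: y Bjy; exact/subsetPset/ndB/leq_maxr.
  move=> k; have [? ?] := Aoo k; have [? ?] := Boo k.
  split; first exact: measurableX.
  by rewrite product_measure1E// lte_mul_pinfty// ge0_fin_numE.
pose tail (x : 'rV[R]_n.+1) : measurableTypeR R * 'rV[R]_n :=
  (x ord0 ord0, \row_j x ord0 (rshift 1 j)).
have mtail : measurable_fun setT tail.
  apply: measurable_fun_pair; first exact: measurable_coord.
  apply: measurable_fun_rV => i.
  by under eq_fun do rewrite mxE; exact: measurable_coord.
have tailK p : tail (cons_rV p) = p.
  case: p => a v; congr pair; last by apply/rowP => j; rewrite mxE cons_rVr.
  by rewrite -[RHS](cons_rVl (a, v) ord0); congr (cons_rV _ _ _); exact: val_inj.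
exists (fun k => tail @^-1` F k).
  by rewrite -preimage_bigcup -UF preimage_setT.
move=> k; have [mFk Fkoo] := Foo k; split.
  by rewrite -[X in measurable X]setTI; exact: mtail.
rewrite /lebesgue_step /pushforward -comp_preimage.
by rewrite (_ : tail \o _ = idfun) //; apply/funext => p /=; rewrite tailK.
Qed.

HB.instance Definition _ := Measure_isSigmaFinite.Build _ _ _ lebesgue_step
  step_sigma_finite.

End lebesgue_rV_step.

(* n-dimensional Lebesgue measure as the n-fold product of lebesgue_measure. *)
Fixpoint lebesgue_rV (R : realType) (n : nat) :
    {sigma_finite_measure set 'rV[R]_n -> \bar R} :=
  match n with
  | 0%N => \d_(0 : 'rV[R]_0)
  | m.+1 => lebesgue_step (lebesgue_rV R m)
  end.

Lemma lebesgue_rV_box (R : realType) n (A : 'I_n -> set R) :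
  (forall i, measurable (A i)) ->
  lebesgue_rV R n [set x | forall i, A i (x ord0 i)] =
  (\prod_(i < n) lebesgue_measure (A i))%E.
Proof.
elim: n A => [|n IH] A mA.
  by rewrite big_ord0 /= diracE mem_set//= => -[].
have E0 : lshift n (ord0 : 'I_1) = ord0 by exact: val_inj.
have ES j : rshift 1 j = lift (ord0 : 'I_n.+1) j by exact: val_inj.
have mB : measurable [set x : 'rV[R]_n | forall i, A (lift ord0 i) (x ord0 i)].
  rewrite (_ : mkset _ = \big[setI/setT]_(i < n)
    (fun x : 'rV[R]_n => x ord0 i) @^-1` A (lift ord0 i)).
    apply: bigsetI_measurable => i _.
    by rewrite -[X in measurable X]setTI; exact: measurable_coord.
  rewrite -bigcap_seq; apply/seteqP; split => x /= Ax i.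
    by move=> _; exact: Ax.
  by apply: Ax; rewrite /= mem_index_enum.
rewrite big_ord_recl -IH// -(@product_measure1E _ _ (measurableTypeR R))//; last exact: (mA ord0).
rewrite /= /lebesgue_step /pushforward; congr product_measure1.
apply/seteqP; split => -[a v] /= => [H|[Aa Av] i].
  split; first by have := H ord0; rewrite -{2}E0 cons_rVl.
  by move=> i; have := H (lift ord0 i); rewrite -{2}ES cons_rVr.
case: (@split_ordP 1 n i) => j ->.
  by rewrite cons_rVl ord1 E0.
by rewrite cons_rVr ES.
Qed.

(* The library norm on 'rV[R]_n is the max norm; it induces the right topology
   but not the Euclidean distances. *)

Section euclidean.
Context {R : realType} {n : nat}.
Implicit Types (x y : 'rV[R]_n) (A : set 'rV[R]_n).

Definition enorm x : R := Num.sqrt (\sum_(i < n) x ord0 i ^+ 2).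

Definition edist_set x A : R := inf [set enorm (x - y) | y in A].

(* equal to -oo on the empty set, in which case fine (ediam _) = 0 *)
Definition ediam A : \bar R :=
  ereal_sup [set (enorm (p.1 - p.2))%:E | p in A `*` A].

Definition boundary A : set 'rV[R]_n := closure A `\` interior A.

Definition opnorm (M : 'M[R]_n) : R :=
  sup [set enorm (v *m M) | v in [set v : 'rV[R]_n | enorm v <= 1]].

Definition curve_length (gamma : R -> 'rV[R]_n) (a b : R) : \bar R :=
  ereal_sup [set (\sum_(0 <= k < size s)
                    enorm (gamma (nth b (a :: s) k.+1)
                           - gamma (nth b (a :: s) k)))%:E
            | s in itv_partition a b].

Definition arclength_param (l : R) (gamma : R -> 'rV[R]_n) : Prop :=
  0 <= l /\ forall t, 0 <= t <= l -> curve_length gamma 0 t = t%:E.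

End euclidean.

Section domains.
Context {R : realType} {n : nat}.
Implicit Types (Omega : set 'rV[R]_n) (x : 'rV[R]_n).

Definition domain Omega : Prop := [/\ Omega !=set0, open Omega & connected Omega].

Definition John_curve Omega (c : R) x0 x (l : R) (gamma : R -> 'rV[R]_n) : Prop :=
  [/\ arclength_param l gamma, gamma 0 = x, gamma l = x0,
      forall t, 0 <= t <= l -> Omega (gamma t) &
      forall t, 0 <= t <= l -> t / c <= edist_set (gamma t) (boundary Omega)].

Definition boundary_John_curve Omega (c : R) x0 xi (l : R)
    (gamma : R -> 'rV[R]_n) : Prop :=
  [/\ arclength_param l gamma, gamma 0 = xi, gamma l = x0,
      forall t, 0 < t <= l -> Omega (gamma t) &
      forall t, 0 <= t <= l -> t / c <= edist_set (gamma t) (boundary Omega)].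

Definition John_domain Omega (c : R) x0 : Prop :=
  [/\ domain Omega, bounded_set Omega, 0 < c, Omega x0 &
      forall x, Omega x -> exists l gamma, John_curve Omega c x0 x l gamma].

Definition uniform_domain Omega : Prop :=
  [/\ domain Omega, bounded_set Omega &
      exists2 c' : R, 0 < c' &
      forall x1 x2, Omega x1 -> Omega x2 ->
      exists gamma : R -> 'rV[R]_n,
        [/\ {within `[0, 1], continuous gamma},
            gamma 0 = x1, gamma 1 = x2,
            forall t, 0 <= t <= 1 -> Omega (gamma t) &
            (curve_length gamma 0 1 <= (c' * enorm (x1 - x2))%:E)%E /\
            forall t, 0 <= t <= 1 ->
              (Order.min (curve_length gamma 0 t) (curve_length gamma t 1)
               <= (c' * edist_set (gamma t) (boundary Omega))%:E)%E]].

Definition uniform_domain_center Omega (c0 : R) x0 : Prop :=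
  uniform_domain Omega /\ John_domain Omega c0 x0.

End domains.

Section finite_distortion.
Context {R : realType} {n : nat}.
Implicit Types (Omega : set 'rV[R]_n) (f : 'rV[R]_n -> 'rV[R]_n).

Local Notation leb := (lebesgue_rV R n).
Local Notation e_ i := (delta_mx ord0 i : 'rV[R]_n).

Definition L1loc Omega (u : 'rV[R]_n -> R) : Prop :=
  forall C, compact C -> C `<=` Omega -> leb.-integrable C (EFin \o u).

Definition iter_partial (s : seq 'I_n) (phi : 'rV[R]_n -> R) : 'rV[R]_n -> R :=
  foldr (fun i g x => 'D_(e_ i) g x) phi s.

Definition smooth (phi : 'rV[R]_n -> R) : Prop :=
  forall s : seq 'I_n, continuous (iter_partial s phi) /\
    forall x i, derivable (iter_partial s phi) x (e_ i).

Definition test_function Omega (phi : 'rV[R]_n -> R) : Prop :=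
  let supp := closure [set x | phi x != 0] in
  [/\ smooth phi, compact supp & supp `<=` Omega].

Definition weak_partial Omega (i : 'I_n) (u g : 'rV[R]_n -> R) : Prop :=
  forall phi, test_function Omega phi ->
    (\int[leb]_(x in Omega) (u x * 'D_(e_ i) phi x)%:E =
     - \int[leb]_(x in Omega) (g x * phi x)%:E)%E.

(* f is in W^{1,1}_loc with weak differential Df. As in the library's jacobian,
   Df x acts on row vectors: v |-> v *m Df x, so Df x i j = d_i f_j. *)
Definition W11loc Omega f (Df : 'rV[R]_n -> 'M[R]_n) : Prop :=
  (forall j, L1loc Omega (fun x => f x ord0 j)) /\
  (forall i j, L1loc Omega (fun x => Df x i j) /\
     weak_partial Omega i (fun x => f x ord0 j) (fun x => Df x i j)).

(* f is the continuous representative, Df its weak differential and K a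
   distortion function for f. *)
Definition finite_distortion Omega f (Df : 'rV[R]_n -> 'M[R]_n)
    (K : 'rV[R]_n -> R) : Prop :=
  [/\ {within Omega, continuous f},
      W11loc Omega f Df,
      L1loc Omega (fun x => \det (Df x)),
      measurable_fun Omega K /\ (forall x, Omega x -> 1 <= K x) &
      {ae leb, forall x, Omega x -> opnorm (Df x) ^+ n <= K x * \det (Df x)}].

Definition class_F (lambda calK : R) Omega (x0 : 'rV[R]_n) f : Prop :=
  f x0 = 0 /\ exists Df K,
    [/\ finite_distortion Omega f Df K,
        (\int[leb]_(x in Omega) (\det (Df x))%:E <= leb Omega)%E &
        (\int[leb]_(x in Omega) (expR (lambda * K x))%:E <= calK%:E)%E].

End finite_distortion.

Section gauges.
Context {R : realType}.
Implicit Type h : R -> R.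

(* A gauge is only constrained near 0; its values at negative or large
   arguments are irrelevant below. *)
Definition gauge h : Prop :=
  h 0 = 0 /\ exists2 d : R, 0 < d &
    [/\ {within `[0, d], continuous h},
        {in `[0, d] &, {homo h : s t / s <= t}} &
        forall t, 0 < t <= d -> 0 < h t].

Definition doubling h : Prop :=
  exists D d : R, 0 < d /\ forall t, 0 < t < d -> h (2 * t) <= D * h t.

Definition gauge_integrable (n : nat) h : Prop :=
  exists2 eps : R, 0 < eps < 1 &
    (\int[lebesgue_measure]_(t in `]0%R, eps[)
       (((h t * ln (1 / t)) `^ (1 / (n%:R - 1))) / t)%:E < +oo)%E.

Definition hausdorff_content n h (d : R) (A : set 'rV[R]_n) : \bar R :=
  ereal_inf [set (\sum_(0 <= k <oo) (h (fine (ediam (E k))))%:E)%E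
            | E in [set E : (set 'rV[R]_n)^nat |
                A `<=` \bigcup_k E k /\ forall k, (ediam (E k) <= d%:E)%E]].

Definition hausdorff_measure n h (A : set 'rV[R]_n) : \bar R :=
  lim (hausdorff_content h d A @[d --> 0^'+]).

(* P holds at H^h-almost every point of A *)
Definition hausdorff_ae n h (A : set 'rV[R]_n) (P : 'rV[R]_n -> Prop) : Prop :=
  hausdorff_measure h [set x | A x /\ ~ P x] = 0%E.

End gauges.

(* Main.v *)
Require Import Defs.
From HB Require Import structures.
From mathcomp Require Import all_boot all_order all_algebra.
From mathcomp Require Import all_classical all_reals all_analysis.
From mathcomp Require Import measurable_realfun.
From mathcomp Require Import ring lra zify.
Set Implicit Arguments.
Unset Strict Implicit.
Unset Printing Implicit Defensive.
Import Order.TTheory GRing.Theory Num.Theory.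
Import numFieldNormedType.Exports.

Local Open Scope classical_set_scope.
Local Open Scope ring_scope.

(* Each component u of f is treated separately, through its averages A(p, r)
   against product bumps supported in the cube of radius r about p. By the very
   definition of weak derivatives, A(p, r) - A(q, r') is bounded by integrals of
   |D u| over a cube containing both supports. The distortion inequality gives,
   for all sigma, s > 0 with ln (1/s) >= 1,
     |D u| <= sigma (2 + s exp (lambda K)) + C ln (1/s) sigma^(1-n) J_f
   almost everywhere. Put I_t = \int J_f over the part of Omega in a cube of
   radius ~ t about a boundary point xi. Summing this estimate over the scales
   2^(-nj) t, with sigma and s adapted to each scale, and averaging over many
   points of a John curve, one finds a point p of the curve at distance ~ t from
   xi with A(p, r) close to the limit of u along the curve, r ~ t. The same holds
   for the other curve, and a uniformity curve joins the two points through
   boundedly many cubes of radius ~ t in Omega. In total the limits differ by at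
   most C (delta + delta^(1-n) ln (1/t) I_t) for every delta > 0, so they agree
   as soon as ln (1/t) I_t tends to 0 along some sequence t -> 0.
     The integral condition gives arbitrarily small t with h(t) ln (1/t) as small
   as wanted. Covering by cubes of such a side and using J_f in L^1 shows that
   the xi where ln (1/t) I_t stays bounded below are H^h-null. *)

(** The obstacle is that the scales cannot be summed at one prescribed point. Put a = 2^j and rho =
    r0 / a^n. Taking rho sigma = delta / a turns the terms linear in sigma into a geometric series,
    but the coefficient of \int J_f becomes (rho sigma)^(1-n), which grows like a^(n-1). Among
    equally spaced points only a fraction ~ rho / t ~ a^(-n) of the cubes contains a given x, and
    a^(n-1) a^(-n) = 1/a is summable again, even against the factor nj + 1 that comes from ln (1/s).
    Radii that are n-th powers keep all exponents integral. Only the spread of one coordinate along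
    the curve is used, so no measure on the curve enters. The summation stops at a finite level, u
    being uniformly continuous on a compact arc. The logarithm has its origin in s: to make s \int
    exp (lambda K) comparable to the volume rho^n, s is a power of t / a^n, and it is paid for only
    through ln (1/s), at most a multiple of (nj + 1) ln (1/t). *)

Section smooth_functions_on_the_line.
Context {R : realType}.
Implicit Types (f g : R -> R) (k : nat) (x p q r s : R).

Lemma is_derive_cvg (V : normedModType R) (f : V -> R) (x v : V) (l : R) :
  h^-1 *: (f (h *: v + x) - f x) @[h --> 0^'] --> l -> is_derive x v f l.
Proof.
move=> H; apply: DeriveDef; first by apply/cvg_ex; exists l.
exact/cvg_lim.
Qed.

Lemma is_derive_unfold (V : normedModType R) (f : V -> R) (x v : V) (l : R) :
  is_derive x v f l -> h^-1 *: (f (h *: v + x) - f x) @[h --> 0^'] --> l.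
Proof. by case=> dv <-; exact: dv. Qed.

Lemma scaleRE (a b : R) : a *: b = a * b.
Proof. by []. Qed.

(* The k-indexed family is closed under differentiation up to linear combinations. *)
Definition flat k x : R := if 0 < x then x^-1 ^+ k * expR (- x^-1) else 0.

Lemma flat_eq0 k x : x <= 0 -> flat k x = 0.
Proof. by rewrite /flat ltNge => ->. Qed.

Lemma flat_ge0 k x : 0 <= flat k x.
Proof.
rewrite /flat; case: ifPn => // x0.
by rewrite mulr_ge0 ?expR_ge0 ?exprn_ge0 ?invr_ge0 ?ltW.
Qed.

Lemma flat_gt0 k x : 0 < x -> 0 < flat k x.
Proof. by move=> x0; rewrite /flat x0 mulr_gt0 ?expR_gt0 ?exprn_gt0 ?invr_gt0. Qed.

Lemma flat_le k x : 0 <= x -> flat k x <= (k.+2)`!%:R * x ^+ 2.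
Proof.
rewrite le_eqVlt => /predU1P[<-|x0]; first by rewrite flat_eq0 // expr0n mulr0.
have y0 : 0 < x^-1 by rewrite invr_gt0.
have F0 : 0 < (k.+2)`!%:R :> R by rewrite ltr0n fact_gt0.
have := expR_ge1Dxn k.+1 (ltW y0).
rewrite /flat x0 expRN => H.
have {}H : x^-1 ^+ k.+2 / (k.+2)`!%:R <= expR x^-1.
  by apply: le_trans H; rewrite lerDr.
rewrite ler_pdivrMr ?expR_gt0 // -ler_pdivrMl ?mulr_gt0 ?exprn_gt0 //.
apply: le_trans H; rewrite le_eqVlt; apply/orP; left; apply/eqP.
rewrite !exprS; field; rewrite ?lt0r_neq0 //.
Qed.

Lemma is_derive_flat k x :
  is_derive x 1 (flat k) (flat k.+2 x - k%:R * flat k.+1 x).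
Proof.
have [x0|x0|->] := ltgtP x 0.
- rewrite !flat_eq0 ?ltW // mulr0 subr0.
  apply: (@near_eq_is_derive _ _ _ (cst 0)).
  near=> y; rewrite flat_eq0 // ltW //; near: y; exact: lt_nbhsl.
- rewrite /flat x0.
  apply: (@near_eq_is_derive _ _ _ (fun y : R => (y^-1) ^+ k * expR (- y^-1))).
    near=> y; suff -> : 0 < y by [].
    by near: y; exact: lt_nbhsr.
  have xn0 : x != 0 by rewrite gt_eqF.
  have dV : is_derive x 1 (fun y : R => y^-1) (- x ^- 2 *: 1) :=
    is_deriveV xn0 (is_derive_id x 1).
  have dN : is_derive x 1 (fun y : R => - y^-1) (- (- x ^- 2 *: 1)) := is_deriveN dV.
  have dE := @is_derive1_comp _ expR (fun y => - y^-1) x _ _ (is_derive_expR _) dN.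
  have := is_deriveM (is_deriveX k dV) dE.
  set u := (X in is_derive _ _ X _).
  rewrite (_ : u = fun y : R => y^-1 ^+ k * expR (- y^-1)); last first.
    by apply/funext => y; rewrite /u !fctE.
  move/is_derive_eq; apply.
  rewrite !scaleRE !fctE /=.
  by case: k {u} => [|k]; rewrite !exprS /=; field.
- rewrite !flat_eq0 // mulr0 subr0; apply: is_derive_cvg.
  have C0 : 0 < (k.+2)`!%:R :> R by rewrite ltr0n fact_gt0.
  apply/cvgr0Pnorm_lt => e e0; near=> h.
  have h0 : h != 0 by near: h; exact: nbhs_dnbhs_neq.
  rewrite (flat_eq0 _ (lexx 0)) subr0 addr0 !scaleRE mulr1.
  have [hn|hp] := leP h 0; first by rewrite flat_eq0 // mulr0 normr0.
  rewrite normrM normfV (gtr0_norm hp) (ger0_norm (flat_ge0 _ _)) ltr_pdivrMl //.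
  apply: le_lt_trans (flat_le k (ltW hp)) _.
  rewrite expr2 mulrCA ltr_pM2l // -ltr_pdivlMl //.
  by rewrite -(gtr0_norm hp); near: h; apply: dnbhs0_lt; rewrite mulr_gt0 ?invr_gt0.
Unshelve. all: by end_near.
Qed.

(* The rule for inverses makes the class closed under the quotient that defines
   the smooth step. *)
Inductive smooth1 : (R -> R) -> Prop :=
| smooth1_flat k : smooth1 (flat k)
| smooth1_cst c : smooth1 (cst c)
| smooth1D f g : smooth1 f -> smooth1 g -> smooth1 (fun x => f x + g x)
| smooth1M f g : smooth1 f -> smooth1 g -> smooth1 (fun x => f x * g x)
| smooth1V f : (forall x, f x != 0) -> smooth1 f -> smooth1 (fun x => (f x)^-1)
| smooth1_affine a b f : smooth1 f -> smooth1 (fun x => f (a * x + b)).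

Lemma is_derive_affine a b x : is_derive x 1 (fun y : R => a * y + b) a.
Proof.
apply: is_derive_cvg.
apply: (@cvg_trans _ (cst a @ 0^')); last exact: cvg_cst.
apply: near_eq_cvg; near=> h.
have h0 : h != 0 by near: h; exact: nbhs_dnbhs_neq.
by rewrite !scaleRE /=; field.
Unshelve. all: by end_near.
Qed.

Lemma smooth1_derive f : smooth1 f ->
  exists2 df, smooth1 df & forall x, is_derive x 1 f (df x).
Proof.
elim=> {f} [k|c|f g _ [df sdf Df] _ [dg sdg Dg]|f g sf [df sdf Df] sg [dg sdg Dg]
    |f f0 sf [df sdf Df]|a b f _ [df sdf Df]].
- exists (fun x => flat k.+2 x + cst (- k%:R) x * flat k.+1 x).
    by apply: smooth1D; [|apply: smooth1M]; constructor.
  by move=> x; apply: is_derive_eq (is_derive_flat k x) _; rewrite /= mulNr.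
- by exists (cst 0); [constructor|move=> x; exact: is_derive_cst].
- by exists (fun x => df x + dg x); [constructor|move=> x; exact: is_deriveD].
- exists (fun x => f x * dg x + g x * df x).
    by apply: smooth1D; apply: smooth1M.
  by move=> x; apply: is_derive_eq (is_deriveM (Df x) (Dg x)) _.
- exists (fun x => cst (-1) x * ((f x)^-1 * (f x)^-1 * df x)).
    apply: smooth1M; first by constructor.
    by apply: smooth1M => //; apply: smooth1M; apply: smooth1V.
  move=> x; apply: is_derive_eq (is_deriveV (f0 x) (Df x)) _.
  by rewrite !scaleRE /=; field.
- exists (fun x => df (a * x + b) * cst a x).
    by apply: smooth1M; [apply: smooth1_affine|constructor].
  move=> x.
  exact: (@is_derive1_comp _ f (fun y => a * y + b) x _ _ (Df _) (is_derive_affine a b x)).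
Qed.

Lemma smooth1_derive1 f : smooth1 f -> smooth1 f^`()%classic.
Proof.
move=> /smooth1_derive[df sdf Df]; suff -> : f^`()%classic = df by [].
by apply/funext => x; rewrite derive1E derive_val.
Qed.

Lemma smooth1_is_derive f x : smooth1 f -> is_derive x 1 f (f^`()%classic x).
Proof.
move=> /smooth1_derive[df sdf Df]; apply: is_derive_eq (Df x) _.
by rewrite derive1E derive_val.
Qed.

Lemma smooth1_continuous f : smooth1 f -> continuous f.
Proof.
move=> /smooth1_derive[df sdf Df] x; apply: differentiable_continuous.
by apply/derivable1_diffP; case: (Df x).
Qed.

Let den x : R := flat 0 (1 + x) + flat 0 (1 - x).

Let den_gt0 x : 0 < den x.
Proof.
rewrite /den; have [x0|x0] := ltP 0 x.
  by apply: ltr_pwDl; [apply: flat_gt0; lra|exact: flat_ge0].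
by apply: ltr_wpDl; [exact: flat_ge0|apply: flat_gt0; lra].
Qed.

Definition step x : R := flat 0 (1 + x) / den x.

(** The derivative of [step], written out by the quotient rule. Its integral is therefore 1 without
    normalization, and a difference of bumps is the derivative of a difference of steps. *)
Definition bump x : R :=
  (flat 2 (1 + x) * flat 0 (1 - x) + flat 0 (1 + x) * flat 2 (1 - x)) / den x ^+ 2.

Lemma bump_ge0 x : 0 <= bump x.
Proof.
by rewrite divr_ge0 ?exprn_ge0 ?(ltW (den_gt0 _)) // addr_ge0 // mulr_ge0 ?flat_ge0.
Qed.

Lemma bump_eq0 x : 1 <= `|x| -> bump x = 0.
Proof.
rewrite /bump ler_normr => /orP[x1|x1].
  by rewrite !(flat_eq0 _ (_ : 1 - x <= 0)) ?mulr0 ?addr0 ?mul0r //; lra.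
by rewrite !(flat_eq0 _ (_ : 1 + x <= 0)) ?mulr0 ?addr0 ?mul0r ?addr0 ?mul0r//; lra.
Qed.

Lemma step_eq0 x : x <= -1 -> step x = 0.
Proof. by move=> x1; rewrite /step flat_eq0 ?mul0r //; lra. Qed.

Lemma step_eq1 x : 1 <= x -> step x = 1.
Proof.
move=> x1; rewrite /step /den (flat_eq0 _ (_ : 1 - x <= 0)) ?addr0; last lra.
by rewrite divff // gt_eqF // flat_gt0 //; lra.
Qed.

Lemma step_ge0 x : 0 <= step x.
Proof. by rewrite divr_ge0 ?flat_ge0 // ltW // den_gt0. Qed.

Lemma step_le1 x : step x <= 1.
Proof. by rewrite ler_pdivrMr ?den_gt0 // mul1r /den lerDl flat_ge0. Qed.

Let flat0_affine a b : smooth1 (fun x => flat 0 (a * x + b)).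
Proof. by apply: smooth1_affine; constructor. Qed.

Let flat0p x : is_derive x 1 (fun x => flat 0 (1 + x)) (flat 2 (1 + x)).
Proof.
have -> : (fun x => flat 0 (1 + x)) = flat 0 \o (fun y => 1 * y + 1).
  by apply/funext => y /=; rewrite mul1r addrC.
apply: is_derive_eq (is_derive1_comp (is_derive_flat _ _) (is_derive_affine 1 1 x)) _.
by rewrite mul0r subr0 mulr1 mul1r addrC.
Qed.

Let flat0m x : is_derive x 1 (fun x => flat 0 (1 - x)) (- flat 2 (1 - x)).
Proof.
have -> : (fun x => flat 0 (1 - x)) = flat 0 \o (fun y => (-1) * y + 1).
  by apply/funext => y /=; rewrite mulN1r addrC.
apply: is_derive_eq (is_derive1_comp (is_derive_flat _ _) (is_derive_affine (-1) 1 x)) _.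
by rewrite mul0r subr0 mulrN1 mulN1r addrC.
Qed.

Lemma smooth1_step : smooth1 step.
Proof.
have s1 : smooth1 (fun x => flat 0 (1 + x)).
  by have := flat0_affine 1 1; congr smooth1; apply/funext => y; rewrite mul1r addrC.
have s2 : smooth1 (fun x => flat 0 (1 - x)).
  by have := flat0_affine (-1) 1; congr smooth1; apply/funext => y; rewrite mulN1r addrC.
apply: smooth1M => //; apply: smooth1V; last exact: smooth1D.
by move=> x; rewrite gt_eqF // den_gt0.
Qed.

Lemma is_derive_step x : is_derive x 1 step (bump x).
Proof.
have d0 : den x != 0 by rewrite gt_eqF // den_gt0.
have dd : is_derive x 1 den (flat 2 (1 + x) - flat 2 (1 - x)).
  exact: is_deriveD (flat0p x) (flat0m x).
apply: is_derive_eq (is_deriveM (flat0p x) (is_deriveV d0 dd)) _.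
rewrite !scaleRE /bump; move: d0; rewrite /den => d0; field.
exact: d0.
Qed.

Lemma smooth1_bump : smooth1 bump.
Proof.
have := smooth1_derive1 smooth1_step; congr smooth1; apply/funext => x.
by rewrite derive1E; have := is_derive_step x => H; rewrite derive_val.
Qed.

Lemma bump_bounded : exists2 C : R, 1 <= C & forall x, bump x <= C.
Proof.
have [||c _ Hc] := @EVT_max R bump (-1) 1; first by lra.
  by apply: continuous_subspaceT => x; exact: smooth1_continuous smooth1_bump x.
exists (Num.max 1 (bump c)) => [|x]; first by rewrite le_max lexx.
rewrite le_max; apply/orP; right; have [x1|x1] := leP 1 `|x|.
  by rewrite bump_eq0 // bump_ge0.
by apply: Hc; rewrite in_itv /=; move: x1; rewrite ltr_norml => /andP[/ltW -> /ltW ->].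
Qed.

Definition bump_at p r x : R := r^-1 * bump (r^-1 * (x - p)).
Definition step_at p r x : R := step (r^-1 * (x - p)).

Lemma smooth1_bump_at p r : smooth1 (bump_at p r).
Proof.
have -> : bump_at p r = fun x => cst r^-1 x * bump (r^-1 * x - r^-1 * p).
  by apply/funext => x; rewrite /bump_at mulrBr.
by apply: smooth1M; [constructor|apply: smooth1_affine; exact: smooth1_bump].
Qed.

Lemma smooth1_step_at p r : smooth1 (step_at p r).
Proof.
have -> : step_at p r = fun x => step (r^-1 * x - r^-1 * p).
  by apply/funext => x; rewrite /step_at mulrBr.
by apply: smooth1_affine; exact: smooth1_step.
Qed.

Lemma is_derive_step_at p r x : is_derive x 1 (step_at p r) (bump_at p r x).
Proof.
have -> : step_at p r = step \o (fun y => r^-1 * y + (- (r^-1 * p))).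
  by apply/funext => y; rewrite /step_at /= mulrBr.
apply: is_derive_eq (is_derive1_comp (is_derive_step _) (is_derive_affine r^-1 _ x)) _.
by rewrite /bump_at mulrBr mulrC.
Qed.

Lemma bump_at_ge0 p r x : 0 <= r -> 0 <= bump_at p r x.
Proof. by move=> r0; rewrite mulr_ge0 ?bump_ge0 // invr_ge0. Qed.

Lemma scaled_norm p r x : 0 < r -> (1 <= `|r^-1 * (x - p)|) = (r <= `|x - p|).
Proof. by move=> r0; rewrite normrM normfV (gtr0_norm r0) ler_pdivlMl // mulr1. Qed.

Lemma bump_at_eq0 p r x : 0 < r -> r <= `|x - p| -> bump_at p r x = 0.
Proof. by move=> r0 h; rewrite /bump_at bump_eq0 ?mulr0 // scaled_norm. Qed.

Lemma step_at_eq0 p r x : 0 < r -> x <= p - r -> step_at p r x = 0.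
Proof.
move=> r0 h; rewrite /step_at step_eq0 // ler_pdivrMl //; lra.
Qed.

Lemma step_at_eq1 p r x : 0 < r -> p + r <= x -> step_at p r x = 1.
Proof.
move=> r0 h; rewrite /step_at step_eq1 // ler_pdivlMl //; lra.
Qed.

Lemma step_at_sub p r q s x : `|step_at p r x - step_at q s x| <= 1.
Proof.
have := step_ge0 (r^-1 * (x - p)); have := step_le1 (r^-1 * (x - p)).
have := step_ge0 (s^-1 * (x - q)); have := step_le1 (s^-1 * (x - q)).
by rewrite /step_at ler_norml; lra.
Qed.

Lemma integral_bump_at (p r : R) : 0 < r ->
  (\int[lebesgue_measure]_x (bump_at p r x)%:E = 1)%E.
Proof.
move=> r0.
have -> : (\int[lebesgue_measure]_x (bump_at p r x)%:E =
    \int[lebesgue_measure]_(x in `[(p - r)%R, (p + r)%R]) (bump_at p r x)%:E)%E.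
  rewrite [RHS]integral_mkcond; apply: eq_integral => x _; rewrite patchE.
  case: ifPn => // /negP xn; rewrite bump_at_eq0 //; rewrite leNgt; apply/negP => h; apply: xn.
  rewrite inE /= in_itv /=; move: h; rewrite ltr_norml; lra.
rewrite (@continuous_FTC2 _ _ (step_at p r)).
- by rewrite (@step_at_eq0 p r (p - r)) // step_at_eq1 // sube0.
- by lra.
- by apply: continuous_subspaceT => x; exact: smooth1_continuous (smooth1_bump_at p r) x.
- split.
  + by move=> x _; case: (is_derive_step_at p r x).
  + by apply: cvg_at_right_filter; exact: smooth1_continuous (smooth1_step_at p r) _.
  + by apply: cvg_at_left_filter; exact: smooth1_continuous (smooth1_step_at p r) _.
- by move=> x _; rewrite derive1E; have H := is_derive_step_at p r x; rewrite derive_val.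
Qed.

Lemma smooth1_measurable f : smooth1 f -> measurable_fun setT f.
Proof. by move=> sf; apply: continuous_measurable_fun; exact: smooth1_continuous. Qed.

End smooth_functions_on_the_line.

(** * Lebesgue measure on row vectors: product integrands, cubes, open sets *)

Section lebesgue_rV_facts.
Context {R : realType}.

(** Tonelli along the recursion that defines [lebesgue_rV]; it gives product bumps the integral
    1. *)
Lemma integral_prod_rV n (F : 'I_n -> R -> R) :
  (forall i, measurable_fun setT (F i)) -> (forall i x, 0 <= F i x) ->
  (\int[lebesgue_rV R n]_x (\prod_i F i (x ord0 i))%:E =
   \prod_i \int[lebesgue_measure]_x (F i x)%:E)%E.
Proof.
elim: n F => [|n IH] F mF F0.
  rewrite big_ord0 /= integral_dirac //; last first.
    by apply/measurable_EFinP; under eq_fun do rewrite big_ord0; exact: measurable_cst.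
  by rewrite big_ord0 mule1 diracE in_setT.
have E0 : lshift n (ord0 : 'I_1) = ord0 by exact: val_inj.
have ES j : rshift 1 j = lift (ord0 : 'I_n.+1) j by exact: val_inj.
have mprod m (G : 'I_m -> R -> R) : (forall i, measurable_fun setT (G i)) ->
    measurable_fun setT (fun x : 'rV[R]_m => (\prod_i G i (x ord0 i))%:E).
  move=> mG; apply/measurable_EFinP; apply: measurable_prod => i _.
  by apply: measurableT_comp => //; exact: measurable_coord.
rewrite /= /lebesgue_step ge0_integral_pushforward //; last 3 first.
- exact: measurable_cons_rV.
- exact: mprod.
- by move=> x _; rewrite lee_fin prodr_ge0.
rewrite preimage_setT /=.
have consE p : (fun x => (\prod_i F i (x ord0 i))%:E) (cons_rV p) =
    ((F ord0 p.1)%:E * (\prod_(i < n) F (lift ord0 i) (p.2 ord0 i))%:E)%E.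
  rewrite /= big_ord_recl -EFinM; congr (_ * _)%:E.
    by rewrite -{2}E0 cons_rVl.
  by apply: eq_bigr => i _; rewrite -{2}ES cons_rVr.
rewrite (eq_integral _ _ (fun p _ => consE p)).
rewrite fubini_tonelli1; last 2 first.
- apply: emeasurable_funM.
    by apply/measurable_EFinP; apply: measurableT_comp => //; exact: mF.
  exact: (measurableT_comp (mprod n (fun i => F (lift ord0 i)) (fun i => mF _))
    (@measurable_snd _ _ (measurableTypeR R) _)).
- by move=> x; apply: mule_ge0; rewrite lee_fin ?F0 ?prodr_ge0.
rewrite /fubini_F /=.
have inner x : (\int[lebesgue_rV R n]_y
    ((F ord0 x)%:E * (\prod_(i < n) F (lift ord0 i) (y ord0 i))%:E) =
    (F ord0 x)%:E * \prod_(i < n) \int[lebesgue_measure]_z (F (lift ord0 i) z)%:E)%E.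
  rewrite -(IH (fun i => F (lift ord0 i))) // ge0_integralZl_EFin //.
  - by move=> y _; rewrite lee_fin prodr_ge0.
  - exact: (mprod n (fun i => F (lift ord0 i)) (fun i => mF _)).
under eq_integral => x _ do rewrite (inner x).
rewrite /= ge0_integralZr //.
- by rewrite big_ord_recl.
- by apply/measurable_EFinP; exact: mF.
- by move=> x _; rewrite lee_fin.
- by apply: prode_ge0 => i _; apply: integral_ge0 => x _; rewrite lee_fin.
Qed.

Context {n : nat}.
Implicit Types (p q x y : 'rV[R]_n) (r s : R).
Local Notation leb := (lebesgue_rV R n).

Definition cube p r : set 'rV[R]_n := [set x | forall i, `|x ord0 i - p ord0 i| <= r].

Let cubeE p r : cube p r =
  [set x | forall i, (fun i : 'I_n => `[p ord0 i - r, p ord0 i + r]%classic) i (x ord0 i)].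
Proof.
apply/seteqP; split => x /= h i; have := h i; rewrite /= in_itv /= ler_norml; lra.
Qed.

Lemma measurable_box (A : 'I_n -> set R) : (forall i, measurable (A i)) ->
  measurable [set x : 'rV[R]_n | forall i, A i (x ord0 i)].
Proof.
move=> mA; rewrite (_ : mkset _ = \big[setI/setT]_(i < n)
    (fun x : 'rV[R]_n => x ord0 i) @^-1` A i).
  apply: bigsetI_measurable => i _.
  by rewrite -[X in measurable X]setTI; exact: measurable_coord.
rewrite -bigcap_seq; apply/seteqP; split => x /= Ax i.
  by move=> _; exact: Ax.
by apply: Ax; rewrite /= mem_index_enum.
Qed.

Lemma measurable_cube p r : measurable (cube p r).
Proof.
rewrite cubeE; exact: (@measurable_box
  (fun i => `[p ord0 i - r, p ord0 i + r]%classic) (fun i => measurable_itv _)).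
Qed.

Lemma compact_cube p r : compact (cube p r).
Proof.
rewrite cubeE; exact: (@rV_compact _ _
  (fun i => `[p ord0 i - r, p ord0 i + r]%classic) (fun i => @segment_compact _ _ _)).
Qed.

Lemma lebesgue_cube p r : 0 <= r -> leb (cube p r) = ((2 * r) ^+ n)%:E.
Proof.
move=> r0; rewrite cubeE.
have -> := (@lebesgue_rV_box _ _ (fun i => `[p ord0 i - r, p ord0 i + r]%classic)
  (fun i => measurable_itv _)).
rewrite (eq_bigr (fun=> (2 * r)%:E)); last first.
  move=> i _; rewrite lebesgue_measure_itv /= lte_fin.
  by case: ltP => h; [rewrite -EFinB; congr _%:E; lra|congr _%:E; lra].
by rewrite prodEFin prodr_const card_ord.
Qed.

Lemma cube_subset p q r s : (forall i, `|p ord0 i - q ord0 i| + r <= s) ->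
  cube p r `<=` cube q s.
Proof.
move=> h x /= px i; have := h i; have := px i.
have := ler_distD (p ord0 i) (x ord0 i) (q ord0 i); lra.
Qed.

Lemma nbhs_cube_ex x (A : set 'rV[R]_n) :
  nbhs x A -> exists2 r : R, 0 < r & cube x r `<=` A.
Proof.
move=> /nbhs_ballP[e /= e0 xA]; exists (e / 2); first by rewrite divr_gt0.
move=> y xy; apply: xA; split => // i j; rewrite (ord1 i) /ball /= distrC.
by apply: le_lt_trans (xy j) _; lra.
Qed.

Lemma nbhs_cube x r : 0 < r -> nbhs x (cube x r).
Proof.
move=> r0; apply/nbhs_ballP; exists r => //= y [_ xy] i.
by have := xy ord0 i; rewrite /ball /= distrC => /ltW.
Qed.

(** Cubes of radius 1/(k+1) about the points of the grid of mesh 1/(k+1), enumerated by [pickle];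
    those that leave A are replaced by the empty set. This makes open sets measurable for the
    coordinate sigma-algebra and carries information on compact subsets over to the whole open
    set. *)
Lemma open_bigcup_compact (A : set 'rV[R]_n) : open A ->
  exists2 F : (set 'rV[R]_n)^nat, A = \bigcup_k F k &
    forall k, measurable (F k) /\ compact (F k).
Proof.
move=> oA.
pose c (kz : nat * {ffun 'I_n -> int}) : 'rV[R]_n :=
  \row_i ((kz.2 i)%:~R / kz.1.+1%:R).
pose F kz := if `[< cube (c kz) kz.1.+1%:R^-1 `<=` A >]
  then cube (c kz) kz.1.+1%:R^-1 else set0.
exists (fun j => if unpickle j is Some kz then F kz else set0); last first.
  move=> j; case: unpickle => [kz|]; last by split; [exact: measurable0|exact: compact0].
  rewrite /F; case: ifP => _; last by split; [exact: measurable0|exact: compact0].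
  by split; [exact: measurable_cube|exact: compact_cube].
apply/seteqP; split => [x Ax|x [j _]]; last first.
  by case: unpickle => // kz; rewrite /F; case: asboolP => // sub /sub.
have [r r0 xA] := nbhs_cube_ex (open_nbhs_nbhs (conj oA Ax)).
have [k k0] := @ltr_add_invr R 0 (r / 2) ltac:(lra).
have K0 : 0 < k.+1%:R :> R by [].
pose z : {ffun 'I_n -> int} := [ffun i => Num.floor (x ord0 i * k.+1%:R)].
have cx i : `|x ord0 i - c (k, z) ord0 i| <= k.+1%:R^-1.
  rewrite mxE /= ffunE.
  have -> : x ord0 i - (Num.floor (x ord0 i * k.+1%:R))%:~R / k.+1%:R =
      (x ord0 i * k.+1%:R - (Num.floor (x ord0 i * k.+1%:R))%:~R) / k.+1%:R.
    by field; rewrite lt0r_neq0.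
  rewrite normrM (gtr0_norm (_ : 0 < k.+1%:R^-1)) ?invr_gt0 //.
  rewrite ler_pdivrMr // mulVf ?lt0r_neq0 //.
  have := Num.Theory.floor_le (x ord0 i * k.+1%:R).
  have := floorD1_gt (x ord0 i * k.+1%:R).
  by rewrite intrD ler_norml; lra.
exists (pickle (k, z)) => //; rewrite pickleK /F; case: asboolP => [_|[]]; first exact: cx.
apply: subset_trans xA; apply: cube_subset => i; rewrite distrC.
move: (cx i) k0; rewrite add0r /=; set u := `|_|; set v := k.+1%:R^-1; lra.
Qed.

Lemma open_measurable_rV (A : set 'rV[R]_n) : open A -> measurable A.
Proof.
move=> /open_bigcup_compact[F -> mF].
by apply: bigcupT_measurable => k; case: (mF k).
Qed.

End lebesgue_rV_facts.

(** * Integrals against a bounded factor that vanishes outside a subset *)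

Section cutoff.
Context d (T : measurableType d) (R : realType) (mu : {measure set T -> \bar R}).
Variables (D Q : set T) (v phi : T -> R) (M : R).
Hypotheses (mD : measurable D) (mQ : measurable Q) (QD : Q `<=` D).
Hypotheses (iv : mu.-integrable Q (EFin \o v)).
Hypotheses (mphi : measurable_fun setT phi) (phiM : forall x, `|phi x| <= M).
Hypotheses (phi0 : forall x, ~ Q x -> phi x = 0).

Let cutE : (fun x => v x * phi x) = (fun x => v x * phi x) \_ Q.
Proof.
apply/funext => x; rewrite patchE; case: ifPn => // /negP xQ.
by rewrite phi0 ?mulr0 // => /mem_set.
Qed.

Let iQ : mu.-integrable Q (EFin \o (fun x => v x * phi x)).
Proof.
have := @integrableMl _ _ _ mu Q mQ (EFin \o v) phi iv (measurable_funTS mphi).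
apply; exists M; split; first exact: num_real.
by move=> N MN x _; apply: le_trans (phiM x) (ltW MN).
Qed.

Lemma integrable_cutoff : mu.-integrable D (EFin \o (fun x => v x * phi x)).
Proof.
have /(_ mu (EFin \o (fun x => v x * phi x)))[+ _] :=
  fun m => @integrable_restrict _ T R m Q mQ D mD.
by rewrite setIC (setIidl QD) restrict_EFin -cutE; exact.
Qed.

Lemma le_Rintegral_cutoff :
  `|\int[mu]_(x in D) (v x * phi x)| <= M * \int[mu]_(x in Q) `|v x|.
Proof.
have -> : \int[mu]_(x in D) (v x * phi x) = \int[mu]_(x in Q) (v x * phi x).
  rewrite {1}cutE -Rintegral_mkcondr; congr (Rintegral _ _ _).
  by rewrite setIC (setIidl QD).
apply: le_trans (le_normr_Rintegral mQ iQ) _.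
have ivn : mu.-integrable Q (EFin \o (fun x => `|v x|)) by exact: integrable_norm.
rewrite -RintegralZl //; apply: le_Rintegral => //.
- exact: integrable_norm.
- exact: (@integrableZl _ _ _ mu Q mQ M _ ivn).
- by move=> x _; rewrite normrM mulrC ler_wpM2r.
Qed.

End cutoff.

(** * Test functions that are products of functions of one coordinate *)

Section product_test_functions.
Context {R : realType} {n : nat}.
Implicit Types (F : 'I_n -> R -> R) (x z : 'rV[R]_n).
Local Notation e_ i := (delta_mx ord0 i : 'rV[R]_n).

Definition prodf F x : R := \prod_i F i (x ord0 i).

Definition upd F i (g : R -> R) : 'I_n -> R -> R := fun j => if j == i then g else F j.

Lemma is_derive_prodf F i x : (forall j, smooth1 (F j)) ->
  is_derive x (e_ i) (prodf F) (prodf (upd F i (F i)^`()%classic) x).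
Proof.
move=> sF; apply: is_derive_cvg.
set c := \prod_(j | j != i) F j (x ord0 j).
have -> : prodf (upd F i (F i)^`()%classic) x = (F i)^`()%classic (x ord0 i) * c.
  rewrite /prodf (bigD1 i) //= /upd eqxx; congr (_ * _).
  by apply: eq_bigr => j /negbTE ->.
have -> : (fun h : R => h^-1 *: (prodf F (h *: e_ i + x) - prodf F x)) =
    (fun h : R => h^-1 *: (F i (h *: 1 + x ord0 i) - F i (x ord0 i)) * c).
  have prodE (y : 'rV[R]_n) : (forall j, j != i -> y ord0 j = x ord0 j) ->
      prodf F y = F i (y ord0 i) * c.
    move=> yx; rewrite /prodf (bigD1 i) //=; congr (_ * _).
    by apply: eq_bigr => j ji; rewrite yx.
  apply/funext => h; rewrite !scaleRE -mulrA; congr (_ * _).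
  rewrite prodE => [|j ji]; last by rewrite !mxE eqxx (negbTE ji) mulr0 add0r.
  by rewrite (prodE x) // -mulrBl !mxE !eqxx.
apply: (@cvgM _ _ _ _ _ (cst c) _ c); last exact: cvg_cst.
exact: is_derive_unfold (smooth1_is_derive _ (sF i)).
Qed.

Lemma continuous_prodf F : (forall j, smooth1 (F j)) -> continuous (prodf F).
Proof.
move=> sF; rewrite /prodf; elim: (index_enum _) => [|j s IH] x.
  rewrite [X in continuous_at _ X](_ : _ = cst 1); first exact: cst_continuous.
  by apply/funext => y; rewrite big_nil.
rewrite [X in continuous_at _ X](_ : _ = (fun y : 'rV[R]_n => F j (y ord0 j)) \*
  (fun y : 'rV[R]_n => \prod_(i <- s) F i (y ord0 i))); last first.
  by apply/funext => y; rewrite big_cons.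
apply: continuousM; last exact: IH.
apply: (@continuous_comp _ _ _ (fun x : 'rV[R]_n => x ord0 j) (F j)).
  exact: coord_continuous.
exact: smooth1_continuous.
Qed.

(** A partial derivative replaces one factor by its derivative, so iterated partials never leave the
    products of [smooth1] functions. *)
Lemma smooth_prodf F : (forall j, smooth1 (F j)) -> smooth (prodf F).
Proof.
move=> sF s.
suff [G sG ->] : exists2 G, (forall j, smooth1 (G j)) & iter_partial s (prodf F) = prodf G.
  split; first exact: continuous_prodf.
  by move=> x i; have [] := is_derive_prodf i x sG.
elim: s => [|i s [G sG IH]]; first by exists F.
exists (upd G i (G i)^`()%classic).
  by move=> j; rewrite /upd; case: ifP => // _; exact: smooth1_derive1.
apply/funext => x; rewrite /= IH.
by have H := is_derive_prodf i x sG; rewrite derive_val.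
Qed.

Lemma prodf_support F z (r : R) x :
  (forall j y, r < `|y - z ord0 j| -> F j y = 0) -> ~ cube z r x -> prodf F x = 0.
Proof.
move=> F0 xz; suff [j jx] : exists j, r < `|x ord0 j - z ord0 j|.
  by rewrite /prodf (bigD1 j) //= F0 // mul0r.
apply: contrapT => H; apply: xz => j; rewrite leNgt; apply/negP => jx.
by apply: H; exists j.
Qed.

Lemma test_function_prodf (Omega : set 'rV[R]_n) F z (r : R) :
  (forall j, smooth1 (F j)) -> (forall j y, r < `|y - z ord0 j| -> F j y = 0) ->
  cube z r `<=` Omega -> test_function Omega (prodf F).
Proof.
move=> sF F0 zO.
have sub : closure [set x | prodf F x != 0] `<=` cube z r.
  have clc : closed (cube z r).
    by apply: compact_closed; [exact: norm_hausdorff|exact: compact_cube].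
  rewrite [X in _ `<=` X](closure_id _).1 //; apply: closureS => x /= /eqP Fx; apply: contrapT => xz.
  by apply: Fx; exact: prodf_support F0 xz.
split; first exact: smooth_prodf.
  exact: (subclosed_compact (@closed_closure _ _) (@compact_cube _ _ z r) sub).
exact: subset_trans zO.
Qed.

Lemma measurable_prodf F : (forall j, smooth1 (F j)) -> measurable_fun setT (prodf F).
Proof.
move=> sF; apply: measurable_prod => i _; apply: measurableT_comp.
  exact: smooth1_measurable.
exact: measurable_coord.
Qed.

End product_test_functions.

(** * Averages against product bumps and their variation *)

Section bump_averages.
Context {R : realType} {n : nat}.
Implicit Types (Omega : set 'rV[R]_n) (u : 'rV[R]_n -> R) (p q x z : 'rV[R]_n).
Local Notation leb := (lebesgue_rV R n).

Definition bumps p (r : R) (i : 'I_n) : R -> R := bump_at (p ord0 i) r.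

Definition avg Omega u p (r : R) : R :=
  \int[leb]_(x in Omega) (u x * prodf (bumps p r) x).

Lemma telescope_ord (D : nat -> R) (m : nat) : D 0%N - D m = \sum_(k < m) (D k - D k.+1).
Proof.
elim: m => [|m IH]; first by rewrite big_ord0 subrr.
by rewrite big_ord_recr /= -IH addrA subrK.
Qed.

Lemma bump_at_le (a r kappa C x : R) : 0 < kappa -> kappa <= r ->
  (forall y : R, bump y <= C) -> bump_at a r x <= C / kappa.
Proof.
move=> k0 kr bC; have r0 : 0 < r by exact: lt_le_trans kr.
have C0 : 0 <= C by apply: le_trans (bC 0); exact: bump_ge0.
have ri : r^-1 <= kappa^-1 by rewrite lef_pV2 ?posrE.
by rewrite /bump_at mulrC ler_pM ?bump_ge0 // invr_ge0 ltW.
Qed.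

Lemma bump_at_support (a b r s y : R) : 0 < r -> `|a - b| + r <= s ->
  s < `|y - b| -> bump_at a r y = 0.
Proof.
move=> r0 h sy; apply: bump_at_eq0 => //.
by have := ler_distD a y b; lra.
Qed.

(** Neither step has bounded support, but both are 0 far to the left and 1 far to the right, so the
    difference has. *)
Lemma step_at_sub_support (a a' b r r' s y : R) : 0 < r -> 0 < r' ->
  `|a - b| + r <= s -> `|a' - b| + r' <= s -> s < `|y - b| ->
  step_at a r y - step_at a' r' y = 0.
Proof.
move=> r0 r'0; have := ler_norm (a - b); have := ler_norm (a' - b).
have := ler_norm (- (a - b)); have := ler_norm (- (a' - b)); rewrite !normrN.
move=> h1 h2 h3 h4 h h'; rewrite ltr_normr => /orP[sy|sy].
  by rewrite !step_at_eq1 ?subrr //; lra.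
by rewrite !step_at_eq0 ?subrr //; lra.
Qed.

(* Replacing the factors of the product bump one coordinate at a time, each
   difference is the partial derivative of a product test function. *)
Lemma avg_diff Omega u (g : 'I_n -> 'rV[R]_n -> R) p q z (r rho s kappa C : R) :
  open Omega -> L1loc Omega u -> (forall i, L1loc Omega (g i)) ->
  (forall i, weak_partial Omega i u (g i)) ->
  cube z s `<=` Omega -> 0 < kappa -> kappa <= r -> kappa <= rho ->
  (forall i, `|p ord0 i - z ord0 i| + r <= s) ->
  (forall i, `|q ord0 i - z ord0 i| + rho <= s) ->
  (forall y : R, bump y <= C) ->
  `|avg Omega u p r - avg Omega u q rho| <=
    (C / kappa) ^+ n.-1 * \sum_i \int[leb]_(x in cube z s) `|g i x|.
Proof.
move=> oO Lu Lg Wg zO k0 kr krho pz qz bC.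
have r0 : 0 < r by exact: lt_le_trans kr.
have rho0 : 0 < rho by exact: lt_le_trans krho.
have mO := open_measurable_rV oO.
have mQ := @measurable_cube _ _ z s.
have cQ := @compact_cube _ _ z s.
have Ck0 : 0 <= C / kappa.
  by rewrite divr_ge0 ?ltW //; apply: lt_le_trans (bC 0); rewrite /bump; apply: divr_gt0;
    rewrite ?exprn_gt0 ?addr_gt0 ?mulr_gt0 ?flat_gt0 //; lra.
pose hyb (k : nat) (j : 'I_n) : R -> R :=
  if (j < k)%N then bumps q rho j else bumps p r j.
have shyb k j : smooth1 (hyb k j).
  by rewrite /hyb; case: ifP => _; exact: smooth1_bump_at.
have hyb0 k j y : s < `|y - z ord0 j| -> hyb k j y = 0.
  by rewrite /hyb; case: ifP => _; exact: bump_at_support.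
have hybC k j y : `|hyb k j y| <= C / kappa.
  have bumpsC (p' : 'rV[R]_n) (r' : R) : kappa <= r' -> `|bumps p' r' j y| <= C / kappa.
    move=> kr'; rewrite /bumps ger0_norm; first exact: bump_at_le.
    by rewrite bump_at_ge0 // (le_trans (ltW k0)).
  by rewrite /hyb; case: ifP => _; exact: bumpsC.
have prodC (F : 'I_n -> R -> R) (A : 'I_n -> R) x : (forall j y, `|F j y| <= A j) ->
    `|prodf F x| <= \prod_j A j.
  by move=> FA; rewrite normr_prod; apply: ler_prod => j _; rewrite normr_ge0 FA.
have ihyb k : leb.-integrable Omega (EFin \o (fun x => u x * prodf (hyb k) x)).
  apply: (@integrable_cutoff _ _ _ leb _ _ _ _ (\prod_(j < n) (C / kappa)) mO mQ zO) => //.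
  - exact: Lu.
  - exact: measurable_prodf.
  - by move=> x; exact: prodC.
  - by move=> x; exact: (prodf_support (hyb0 k)).
pose D k := \int[leb]_(x in Omega) (u x * prodf (hyb k) x).
have -> : avg Omega u p r = D 0%N by [].
have -> : avg Omega u q rho = D n.
  rewrite /avg /D; congr (Rintegral _ _ _); apply/funext => x; congr (_ * _).
  by apply: eq_bigr => j _; rewrite /hyb ltn_ord.
rewrite telescope_ord.
apply: le_trans (ler_norm_sum _ _ _) _; rewrite mulr_sumr; apply: ler_sum => k _.
pose st := fun y => step_at (p ord0 k) r y - step_at (q ord0 k) rho y.
pose phi := upd (hyb k) k st.
have sst : smooth1 st.
  rewrite (_ : st = fun y => step_at (p ord0 k) r y + cst (-1) y * step_at (q ord0 k) rho y).
    by apply: smooth1D; [|apply: smooth1M; first constructor]; exact: smooth1_step_at.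
  by apply/funext => y; rewrite mulN1r.
have sphi j : smooth1 (phi j) by rewrite /phi /upd; case: ifP.
have phi0 j y : s < `|y - z ord0 j| -> phi j y = 0.
  rewrite /phi /upd; case: eqP => [->|_]; last exact: hyb0.
  exact: step_at_sub_support.
(* The k-th factor is a difference of steps, bounded by 1, so only n - 1 powers of C / kappa occur.
   This exponent later pairs with sigma^(1-n) to form (rho sigma)^(1-n). *)
have phiC x : `|prodf phi x| <= (C / kappa) ^+ n.-1.
  apply: le_trans (prodC _ (fun j => if j == k then 1 else C / kappa) _ _) _.
    move=> j y; rewrite /phi /upd; case: ifP => _; last exact: hybC.
    exact: step_at_sub.
  rewrite (bigD1 k) //= eqxx mul1r (eq_bigr (fun=> C / kappa)).
    by rewrite prodr_const cardC1 card_ord.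
  by move=> j /negbTE ->.
have dst : st^`()%classic = fun y => bumps p r k y - bumps q rho k y.
  apply/funext => y; rewrite derive1E.
  have H : is_derive y 1 st (bumps p r k y - bumps q rho k y).
    exact: is_deriveB (is_derive_step_at _ _ _) (is_derive_step_at _ _ _).
  by rewrite derive_val.
have Dphi x : 'D_(delta_mx ord0 k) (prodf phi) x = prodf (hyb k) x - prodf (hyb k.+1) x.
  have H := is_derive_prodf k x sphi; rewrite derive_val.
  rewrite /prodf (bigD1 k) //= [X in X - _](bigD1 k) //= [X in _ - X](bigD1 k) //=.
  rewrite /upd eqxx /phi /upd eqxx dst.
  rewrite (eq_bigr (fun j => hyb k j (x ord0 j))); last by move=> j /negbTE ->.
  rewrite [X in _ = _ - _ * X](eq_bigr (fun j => hyb k j (x ord0 j))).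
    by rewrite -mulrBl /hyb ltnn ltnSn.
  move=> j jk; rewrite /hyb ltnS leq_eqVlt.
  by have -> : (j == k :> nat) = false by apply/negbTE.
have tphi : test_function Omega (prodf phi) by exact: test_function_prodf zO.
have -> : D k - D k.+1 = - \int[leb]_(x in Omega) (g k x * prodf phi x).
  rewrite -RintegralB // /Rintegral -fineN -(Wg k _ tphi); congr fine.
  by apply: eq_integral => x _; rewrite Dphi mulrBr.
rewrite normrN; apply: le_Rintegral_cutoff => //.
- exact: Lg.
- exact: measurable_prodf.
- by move=> x; exact: (prodf_support phi0).
Qed.

(** The product bump is nonnegative with integral 1, so [avg] is a weighted mean of u over the
    cube. *)
Lemma avg_near Omega u p (r a e : R) : open Omega -> L1loc Omega u ->
  cube p r `<=` Omega -> 0 < r -> (forall y, cube p r y -> `|u y - a| <= e) ->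
  `|avg Omega u p r - a| <= e.
Proof.
move=> oO Lu pO r0 ua.
have mO := open_measurable_rV oO.
have mQ := @measurable_cube _ _ p r.
have cQ := @compact_cube _ _ p r.
have sb i : smooth1 (bumps p r i) by exact: smooth1_bump_at.
have [C C1 bC] := @bump_bounded R.
have p0 x : 0 <= prodf (bumps p r) x.
  by apply: prodr_ge0 => i _; rewrite bump_at_ge0 // ltW.
have pC x : `|prodf (bumps p r) x| <= \prod_(j < n) (C / r).
  rewrite normr_prod; apply: ler_prod => j _; rewrite normr_ge0 /= /bumps ger0_norm.
    exact: bump_at_le.
  by rewrite bump_at_ge0 // ltW.
have supp x : ~ cube p r x -> prodf (bumps p r) x = 0.
  apply: prodf_support => j y ry; apply: bump_at_support ry => //.
  by rewrite subrr normr0 add0r.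
have intp : \int[leb]_(x in Omega) prodf (bumps p r) x = 1.
  rewrite Rintegral_mkcond /Rintegral.
  rewrite (eq_integral (fun x => (prodf (bumps p r) x)%:E)).
    rewrite integral_prod_rV.
    - under eq_bigr do rewrite integral_bump_at //.
      by rewrite big1.
    - by move=> i; exact: smooth1_measurable.
    - by move=> i x; rewrite bump_at_ge0 // ltW.
  move=> x _; rewrite patchE; case: ifPn => // /negP xO; rewrite supp // => xp.
  by apply: xO; rewrite inE; exact: pO.
have mp := measurable_prodf sb.
have i1 : leb.-integrable Omega (EFin \o (fun x => u x * prodf (bumps p r) x)).
  by apply: (@integrable_cutoff _ _ _ leb _ _ _ _ _ mO mQ pO (Lu _ cQ pO) mp pC supp).
have icst (b : R) : leb.-integrable (cube p r) (EFin \o (fun=> b)).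
  apply/integrableP; split; first exact/measurable_EFinP/measurable_cst.
  rewrite /= integral_cst // [X in (_ * X)%E](lebesgue_cube _ (ltW r0)).
  by rewrite -EFinM ltry.
have i2 b : leb.-integrable Omega (EFin \o (fun x => b * prodf (bumps p r) x)).
  exact: (@integrable_cutoff _ _ _ leb _ _ _ _ _ mO mQ pO (icst b) mp pC supp).
have i0 : leb.-integrable Omega (EFin \o (prodf (bumps p r))).
  by have := i2 1; congr (_.-integrable _ (_ \o _)); apply/funext => x; rewrite mul1r.
have cut b : \int[leb]_(x in Omega) (b * prodf (bumps p r) x) = b.
  by rewrite RintegralZl // intp mulr1.
rewrite /avg -[X in _ - X](cut a) -RintegralB //.
have i3 : leb.-integrable Omega (EFin \o (fun x => u x * prodf (bumps p r) x - a * prodf (bumps p r) x)).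
  by have := integrableB mO i1 (i2 a).
apply: le_trans (le_normr_Rintegral mO i3) _.
rewrite -[X in _ <= X](cut e); apply: le_Rintegral => //; first exact: integrable_norm.
move=> x Ox; rewrite -mulrBl normrM (ger0_norm (p0 x)).
have [xp|/supp ->] := pselect (cube p r x); last by rewrite !mulr0.
by rewrite ler_wpM2r // ua.
Qed.

End bump_averages.

(** * From the distortion inequality to a pointwise bound with free parameters *)

Section pointwise_distortion.
Context {R : realType}.

(* With L = (2 / lam) ln (1 / s) and m = max 1 (K / L), compare y with m sigma:
   if y exceeds it, then y sigma^(n-1) m^(n-1) <= y^n <= K J <= L m J. *)
Lemma distortion_young (n : nat) (y K J sigma s lam : R) : (2 <= n)%N ->
  0 <= y -> 1 <= K -> y ^+ n <= K * J -> 0 < sigma -> 0 < lam ->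
  0 < s -> 1 <= ln s^-1 ->
  y <= sigma * (2 + s * expR (lam * K)) + 2 / lam * ln s^-1 / sigma ^+ n.-1 * `|J|.
Proof.
move=> n2 y0 K1 yKJ sg0 lam0 s0 s1.
have K0 : 0 < K by apply: lt_le_trans K1.
have J0 : 0 <= J by rewrite -(pmulr_rge0 _ K0); apply: le_trans yKJ; exact: exprn_ge0.
rewrite ger0_norm //.
set L := 2 / lam * ln s^-1; set G := expR _.
have L0 : 0 < L by rewrite mulr_gt0 ?divr_gt0 // (lt_le_trans _ s1).
have G0 : 0 < G := expR_gt0 _.
have sG : 0 < s * G by exact: mulr_gt0.
pose m := Num.max 1 (K / L).
have m1 : 1 <= m by rewrite le_max lexx.
have KmL : K <= m * L by rewrite -ler_pdivrMr // le_max lexx orbT.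
have mG : m <= 2 + s * G.
  rewrite ge_max; apply/andP; split; first by lra.
  (* If K > L, split expR (lam K) into two factors expR (lam K / 2): one is at least 1/s because lam
     L / 2 = ln (1/s), the other at least lam K / 2, which dominates K / L because ln (1/s) >= 1. *)
  have [KL|LK] := leP K L; first by rewrite ler_pdivrMr //; nra.
  have w0 : 0 <= lam * K / 2 by rewrite divr_ge0 // mulr_ge0 ?ltW.
  have GE : s^-1 * (lam * K / 2) <= G.
    have -> : G = expR (lam * K / 2) * expR (lam * K / 2).
      by rewrite -expRD /G; congr expR; field.
    have h1 : s^-1 <= expR (lam * K / 2).
      rewrite -{1}(@lnK _ s^-1) ?posrE ?invr_gt0 // ler_expR.
      have : L * lam < K * lam by rewrite ltr_pM2r.
      have -> : L * lam = 2 * ln s^-1 by rewrite /L; field; rewrite gt_eqF.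
      lra.
    have h2 : lam * K / 2 <= expR (lam * K / 2).
      by apply: le_trans (expR_ge1Dx _); rewrite lerDr.
    by rewrite ler_pM // invr_ge0 ltW.
  have : lam * K / 2 <= s * G by rewrite -ler_pdivrMl.
  have : K / L <= lam * K / 2.
    rewrite ler_pdivrMr //.
    have -> : lam * K / 2 * L = K * ln s^-1 by rewrite /L; field; rewrite gt_eqF.
    by rewrite ler_peMr // ltW.
  lra.
have sgn : 0 < sigma ^+ n.-1 by exact: exprn_gt0.
have [ym|my] := leP y (sigma * m).
  apply: le_trans ym _; rewrite -[leLHS]addr0 lerD ?ler_wpM2l ?(ltW sg0) //.
  by rewrite mulr_ge0 // divr_ge0 // ltW.
rewrite -[leLHS]add0r lerD //; first by rewrite mulr_ge0 ?ltW // addr_gt0.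
rewrite mulrAC ler_pdivlMr //.
have sm0 : 0 < sigma * m by rewrite mulr_gt0 // (lt_le_trans _ m1).
have H1 : y * (sigma * m) ^+ n.-1 <= y ^+ n.
  case: n n2 {yKJ sgn} => // n _ /=; rewrite exprS ler_wpM2l //.
  by rewrite lerXn2r ?nnegrE ?(ltW sm0) // ltW.
have H2 : y * (sigma * m) ^+ n.-1 <= m * L * J.
  by apply: le_trans H1 _; apply: le_trans yKJ _; rewrite ler_wpM2r.
have mn : m <= m ^+ n.-1.
  by case: n n2 {yKJ sgn H1 H2} => [|[|n]] // _ /=; rewrite exprS ler_peMr ?exprn_ege1 // (le_trans _ m1).
have m0 : 0 < m by exact: lt_le_trans m1.
rewrite -(ler_pM2l m0); apply: le_trans (_ : y * (sigma * m) ^+ n.-1 <= _); last by rewrite mulrA.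
rewrite exprMn mulrA mulrC; rewrite [leRHS]mulrC.
by rewrite -[leRHS]mulrA ler_wpM2l ?(ltW sgn) // ler_wpM2r.
Qed.

End pointwise_distortion.

(** * Counting points of a progression and bounded overlap *)

Section overlap.
Context {R : realType}.

(** All admissible indices lie between the least and the greatest one, which differ by at most 2 rho
    / dl; the 1 counts both ends. *)
Lemma card_near_progression (N : nat) (x al dl rho : R) : 0 < dl -> 0 <= rho ->
  #|[pred a : 'I_N | `|x - (al + a%:R * dl)| <= rho]|%:R <= 2 * rho / dl + 1 :> R.
Proof.
move=> d0 rho0; set S := [pred a | _].
have [a0 Sa0|S0] := pickP S; last first.
  rewrite (eq_card0 S0).
  by rewrite addr_ge0 // divr_ge0 ?mulr_ge0 // ltW.
pose lo := [arg min_(a < a0 in S) val a]; pose hi := [arg max_(a > a0 in S) val a].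
have [Slo lolt] : S lo /\ forall a, S a -> (lo <= a)%N by rewrite /lo; case: arg_minnP.
have [Shi higt] : S hi /\ forall a, S a -> (a <= hi)%N by rewrite /hi; case: arg_maxnP.
have lohi := lolt _ Shi.
have card : (#|S| <= hi - lo + 1)%N.
  rewrite cardE -(size_map val) -(size_iota lo (hi - lo + 1)).
  apply: uniq_leq_size; first by rewrite map_inj_uniq ?enum_uniq //; exact: val_inj.
  move=> k /mapP[a]; rewrite mem_enum => Sa ->; rewrite mem_iota lolt //=.
  by rewrite addnA subnKC // addn1 ltnS higt.
apply: (@le_trans _ _ (hi - lo + 1)%:R); first by rewrite ler_nat.
rewrite natrD lerD2r natrB // ler_pdivlMr // mulrBl.
move: Slo Shi; rewrite /S /= !ler_norml; lra.
Qed.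

(** The sum of the indicators of the Q a is at most M on U. *)
Lemma sum_integral_overlap d (T : measurableType d) (mu : {measure set T -> \bar R})
    (I : finType) (Q : I -> set T) (U : set T) (J : T -> R) (M : R) :
  measurable U -> (forall a, measurable (Q a)) -> (forall a, Q a `<=` U) ->
  (forall x, 0 <= J x) -> measurable_fun U J -> 0 <= M ->
  (forall x, U x -> #|[pred a | `[< Q a x >]]|%:R <= M) ->
  (\sum_a \int[mu]_(x in Q a) (J x)%:E <= M%:E * \int[mu]_(x in U) (J x)%:E)%E.
Proof.
move=> mU mQ QU J0 mJ M0 QM.
have eQ a : (\int[mu]_(x in Q a) (J x)%:E =
    \int[mu]_(x in U) ((`[< Q a x >]%:R * J x)%R)%:E)%E.
  rewrite -{1}(setIidr (QU a)) integral_mkcondr; apply: eq_integral => x _.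
  rewrite patchE; case: ifPn => [/set_mem Qx|/negP Qx].
    by rewrite asboolT // mul1r.
  by rewrite asboolF ?mul0r // => /mem_set.
have mind a : measurable_fun U (fun x => (`[< Q a x >]%:R * J x)%:E).
  apply/measurable_EFinP; apply: measurable_funM => //.
  rewrite (_ : (fun x => _) = \1_(Q a)); first exact: measurable_indic.
  apply/funext => x; rewrite indicE.
  by case: asboolP => Qx; [rewrite mem_set|rewrite memNset].
rewrite (eq_bigr _ (fun a _ => eQ a)) -ge0_integral_sum //; last first.
  by move=> a x Ux; rewrite lee_fin mulr_ge0.
rewrite -ge0_integralZl_EFin //; last 2 first.
- by move=> x _; rewrite lee_fin.
- exact/measurable_EFinP.
apply: ge0_le_integral => //.
- by move=> x Ux; apply: sume_ge0 => a _; rewrite lee_fin mulr_ge0.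
- exact: emeasurable_sum.
- by apply: measurable_funeM; exact/measurable_EFinP.
- move=> x Ux; rewrite sumEFin -EFinM lee_fin -mulr_suml ler_wpM2r //.
  apply: le_trans (QM x Ux); rewrite -natr_sum ler_nat -sum1_card [leqRHS]big_mkcond /=.
  by apply: leq_sum => a _; rewrite inE; case: `[< _ >].
Qed.

End overlap.

(** * The Euclidean norm against coordinates *)

Section euclidean_facts.
Context {R : realType} {n : nat}.
Implicit Types (x y : 'rV[R]_n).

Lemma enorm_ge0 x : 0 <= enorm x.
Proof. exact: sqrtr_ge0. Qed.

Lemma coord_le_enorm x i : `|x ord0 i| <= enorm x.
Proof.
rewrite /enorm -sqrtr_sqr ler_wsqrtr // (bigD1 i) //= lerDl.
by apply: sumr_ge0 => j _; exact: sqr_ge0.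
Qed.

Lemma enorm_le_coord x (r : R) : 0 <= r -> (forall i, `|x ord0 i| <= r) ->
  enorm x <= n%:R * r.
Proof.
move=> r0 xr; have nr0 : 0 <= n%:R * r by rewrite mulr_ge0.
rewrite -(ger0_norm nr0) -sqrtr_sqr /enorm ler_wsqrtr //.
apply: (@le_trans _ _ (\sum_(i < n) r ^+ 2)).
  by apply: ler_sum => i _; rewrite -real_normK ?num_real // lerXn2r ?nnegrE.
rewrite sumr_const card_ord exprMn -[_ *+ n]mulr_natl ler_wpM2r ?sqr_ge0 //.
by rewrite -natrX ler_nat; case: (n) => // k; rewrite leq_pmulr.
Qed.

Lemma rV_norm_le x (r : R) : 0 <= r -> (`|x| <= r) <-> (forall i, `|x ord0 i| <= r).
Proof.
move=> r0; rewrite [`|x|]mx_normrE; split => [/bigmax_leP[_ H] i|H].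
  exact: (H (ord0, i)).
by apply/bigmax_leP; split => // -[i j] _ /=; rewrite (ord1 i).
Qed.

Lemma edist_set_le x y (A : set 'rV[R]_n) : A y -> edist_set x A <= enorm (x - y).
Proof.
move=> Ay; apply: ge_inf; last by exists y.
by exists 0 => _ [z _ <-]; exact: enorm_ge0.
Qed.

End euclidean_facts.

(** * Curve length, arc length parametrization and chains along a curve *)

Section curve_length_facts.
Context {R : realType} {n : nat}.
Implicit Types (gamma : R -> 'rV[R]_n) (a b : R) (s : seq R).

Fixpoint polygon_length gamma a s : R :=
  if s is x :: s' then enorm (gamma x - gamma a) + polygon_length gamma x s' else 0.

Lemma polygon_lengthE gamma a b s :
  \sum_(0 <= k < size s) enorm (gamma (nth b (a :: s) k.+1) - gamma (nth b (a :: s) k)) =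
  polygon_length gamma a s.
Proof.
elim: s a => [|x s IH] a /=; first by rewrite big_geq.
by rewrite big_nat_recl //= IH.
Qed.

Lemma polygon_length_rcons gamma a s x :
  polygon_length gamma a (rcons s x) =
  polygon_length gamma a s + enorm (gamma x - gamma (last a s)).
Proof.
by elim: s a => [|y s IH] a /=; rewrite ?addr0 ?add0r // IH addrA.
Qed.

Lemma polygon_length_le gamma a b s : itv_partition a b s ->
  ((polygon_length gamma a s)%:E <= curve_length gamma a b)%E.
Proof.
move=> abs; apply: ereal_sup_ubound; exists s => //.
by rewrite polygon_lengthE.
Qed.

Lemma curve_length_le gamma a b (M : \bar R) :
  (forall s, itv_partition a b s -> ((polygon_length gamma a s)%:E <= M)%E) ->
  (curve_length gamma a b <= M)%E.
Proof.
move=> H; apply: ge_ereal_sup => _ [s abs <-].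
by rewrite polygon_lengthE; exact: H.
Qed.

Lemma enorm_le_curve_length gamma a b : a <= b ->
  ((enorm (gamma b - gamma a))%:E <= curve_length gamma a b)%E.
Proof.
rewrite le_eqVlt => /predU1P[->|ab].
  apply: le_trans (polygon_length_le gamma (s := [::]) _); last by split => /=.
  rewrite lee_fin /= subrr; have := @enorm_le_coord R n 0 0 (lexx _).
  by rewrite mulr0; apply => i; rewrite mxE normr0.
apply: le_trans (polygon_length_le gamma (itv_partition1 ab)).
by rewrite /= addr0.
Qed.

Lemma curve_length_split gamma a c b : a < c -> c <= b ->
  ((enorm (gamma c - gamma a))%:E + curve_length gamma c b <= curve_length gamma a b)%E.
Proof.
move=> ac cb; rewrite -leeBrDl //; apply: curve_length_le => s [cs lb].
rewrite leeBrDl // -EFinD; apply: (@polygon_length_le gamma a b (c :: s)).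
by split => //=; rewrite ac.
Qed.

(** Appending t to a partition of [0, s] shows that the length up to s plus the chord is at most the
    length up to t. *)
Lemma arclength_lipschitz gamma (l s t : R) : arclength_param l gamma ->
  0 <= s -> s <= t -> t <= l -> enorm (gamma t - gamma s) <= t - s.
Proof.
move=> [_ H] s0; rewrite le_eqVlt => /predU1P[<-|st] tl.
  rewrite !subrr; have := @enorm_le_coord R n 0 0 (lexx _).
  by rewrite mulr0; apply => i; rewrite mxE normr0.
have ts0 : 0 <= t <= l by rewrite tl (le_trans s0) // ltW.
have ss0 : 0 <= s <= l by rewrite s0 (le_trans (ltW st)).
suff : (s%:E <= (t - enorm (gamma t - gamma s))%:E)%E by rewrite lee_fin; lra.
rewrite -(H s ss0); apply: curve_length_le => p [p1 /eqP p2].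
have : itv_partition 0 t (rcons p t).
  by split; rewrite ?last_rcons // rcons_path p1 p2.
move=> /(polygon_length_le gamma); rewrite (H t ts0) polygon_length_rcons p2.
by rewrite !lee_fin; lra.
Qed.

Lemma arclength_coord_lipschitz gamma (l s t : R) i : arclength_param l gamma ->
  0 <= s <= l -> 0 <= t <= l -> `|gamma s ord0 i - gamma t ord0 i| <= `|s - t|.
Proof.
move=> ag; wlog le : s t / s <= t => [H sl tl|/andP[s0 sl] /andP[t0 tl]].
  by have [st|/ltW ts] := leP s t; [exact: H|rewrite distrC (distrC s); exact: H].
rewrite distrC (distrC s) (@ger0_norm _ (t - s)) ?subr_ge0 //.
apply: le_trans (arclength_lipschitz ag s0 le tl).
by have := coord_le_enorm (gamma t - gamma s) i; rewrite !mxE.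
Qed.

Lemma arclength_continuous gamma (l : R) : arclength_param l gamma ->
  {within `[0, l], continuous gamma}.
Proof.
move=> ag; apply/subspace_continuousP => x; rewrite /= in_itv /= => xl.
apply/cvgrPdist_le => /= e e0.
rewrite near_withinE; near=> y => /=; rewrite in_itv /= => yl.
apply/(rV_norm_le _ (ltW e0)) => i; rewrite !mxE.
apply: le_trans (arclength_coord_lipschitz i ag xl yl) _.
by near: y; apply: cvgr_dist_le => //.
Unshelve. all: by end_near.
Qed.

(* Greedy chain: cut the curve at its first exit from a sup-norm ball of
   radius r; each cut uses up at least r of the length. *)
Lemma chain_estimate (kappa : R -> 'rV[R]_n) (A : 'rV[R]_n -> R) (r D : R) (M : nat) (a b : R) :
  0 < r -> 0 <= D -> a <= b -> {within `[a, b], continuous kappa} ->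
  (forall s t : R, a <= s <= b -> a <= t <= b ->
    (forall i, `|kappa t ord0 i - kappa s ord0 i| <= r) -> `|A (kappa s) - A (kappa t)| <= D) ->
  (curve_length kappa a b <= (M%:R * r)%:E)%E ->
  `|A (kappa a) - A (kappa b)| <= M.+1%:R * D.
Proof.
move=> r0 D0; elim: M a => [|M IH] a ab ck AD.
  rewrite mul0r mul1r => len; apply: AD; rewrite ?lexx ?ab // => i.
  have := le_trans (enorm_le_curve_length kappa ab) len; rewrite lee_fin.
  have := coord_le_enorm (kappa b - kappa a) i; rewrite !mxE; lra.
move=> len.
have [small|/negP] := pselect (`|kappa b - kappa a| <= r).
  have /(rV_norm_le _ (ltW r0)) small' := small.
  apply: le_trans (AD a b _ _ _) _; rewrite ?lexx ?ab //.
    by move=> i; have := small' i; rewrite !mxE.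
  by rewrite ler_peMl // ler1n.
rewrite -ltNge => big.
have cf : {within `[a, b], continuous (fun s : R => `|kappa s - kappa a|)}.
  apply/subspace_continuousP => x xab.
  have h := (subspace_continuousP _ _).1 ck x xab.
  exact: cvg_norm (cvgB h (cvg_cst _)).
have [|c] := @IVT R (fun s : R => `|kappa s - kappa a|) a b r ab cf.
  by rewrite subrr normr0 ge_min (ltW r0) /= le_max (ltW big) orbT.
rewrite in_itv /= => /andP[ac cb] cr.
have ac' : a < c.
  rewrite lt_neqAle ac andbT; apply/eqP => acE; move: cr.
  by rewrite -acE subrr normr0 => r0'; move: r0; rewrite -r0' ltxx.
have lenc : (curve_length kappa c b <= (M%:R * r)%:E)%E.
  have := le_trans (curve_length_split kappa ac' cb) len.
  have re : r <= enorm (kappa c - kappa a).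
    rewrite -cr; apply/(rV_norm_le _ (enorm_ge0 _)) => i; exact: coord_le_enorm.
  rewrite -leeBrDl // => /le_trans; apply.
  by rewrite -EFinB lee_fin -natr1 mulrDl mul1r; lra.
have sub : `[c, b] `<=` `[a, b].
  by move=> x /=; rewrite !in_itv /= => /andP[cx ->]; rewrite (le_trans ac).
have ckc : {within `[c, b], continuous kappa} by exact: continuous_subspaceW ck.
have ADc (s t : R) : c <= s <= b -> c <= t <= b ->
    (forall i, `|kappa t ord0 i - kappa s ord0 i| <= r) -> `|A (kappa s) - A (kappa t)| <= D.
  by move=> /andP[cs sb] /andP[ct tb]; apply: AD; rewrite ?sb ?tb (le_trans ac).
have H := IH c cb ckc ADc lenc.
have H1 : `|A (kappa a) - A (kappa c)| <= D.
  apply: AD; rewrite ?lexx ?ab ?ac ?cb //.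
  have : `|kappa c - kappa a| <= r by rewrite cr.
  by move=> /(rV_norm_le _ (ltW r0)) h i; have := h i; rewrite !mxE.
rewrite -natr1 mulrDl mul1r.
by have := ler_distD (A (kappa c)) (A (kappa a)) (A (kappa b)); lra.
Qed.

End curve_length_facts.

(** * Cubes that miss the boundary *)

Section boundary_facts.
Context {R : realType} {n : nat}.
Implicit Types (Omega : set 'rV[R]_n) (x y z : 'rV[R]_n).

Lemma boundary_open Omega x : open Omega -> boundary Omega x -> ~ Omega x.
Proof. by move=> oO [_ nx] Ox; apply: nx; exact: (open_nbhs_nbhs (conj oO Ox)). Qed.

(** The segment from z to a point of the cube is connected and misses the boundary, so its part in
    Omega is both relatively open and relatively closed. *)
Lemma cube_sub_domain Omega z (r : R) : open Omega -> Omega z -> 0 <= r ->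
  (forall y, boundary Omega y -> ~ cube z r y) -> cube z r `<=` Omega.
Proof.
move=> oO Oz r0 nb w zw.
pose seg (s : R) := z + s *: (w - z).
have cseg : continuous seg.
  move=> s; apply: (@cvgD _ _ _ (nbhs s) _ (cst z)); first exact: cvg_cst.
  by apply: (@cvgZr_tmp _ _ _ (nbhs s)); exact: cvg_id.
pose A := seg @` `[0, 1]%classic.
have cA : connected A.
  apply: connected_continuous_connected; first exact: segment_connected.
  exact: continuous_subspaceT.
have Az : A `<=` cube z r.
  move=> _ [s /= + <-] i; rewrite in_itv /= => /andP[s0 s1].
  rewrite !mxE addrAC subrr add0r normrM ger0_norm //.
  by apply: le_trans (zw i); rewrite ler_piMl.
have Aw : A w by exists 1 => //=; rewrite ?in_itv /= ?lexx ?ler01 // /seg scale1r addrC subrK.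
suff AO : A `&` Omega = A by move: Aw; rewrite -AO => -[].
apply: cA.
- by exists z; split => //; exists 0; rewrite /= ?in_itv /= ?lexx ?ler01 // /seg scale0r addr0.
- by exists Omega.
- exists (closure Omega); first exact: closed_closure.
  apply/seteqP; split => [y [Ay Oy]|y [Ay cOy]]; split => //; first exact: subset_closure.
  apply: contrapT => nOy; apply: (nb y); last exact: Az.
  by split=> // /interior_subset.
Qed.

End boundary_facts.

(** * Oscillation of averages controlled by the integral of J *)

Section energy.
Context {R : realType} {n : nat}.
Local Notation leb := (lebesgue_rV R n).
Variables (Omega : set 'rV[R]_n) (u : 'rV[R]_n -> R) (g : 'I_n -> 'rV[R]_n -> R).
Variables (G J : 'rV[R]_n -> R) (lam C : R).
Hypotheses (n2 : (2 <= n)%N) (oO : open Omega) (lam0 : 0 < lam).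
Hypotheses (Lu : L1loc Omega u) (Lg : forall i, L1loc Omega (g i)).
Hypothesis Wg : forall i, weak_partial Omega i u (g i).
Hypotheses (G0 : forall x, 0 <= G x) (J0 : forall x, 0 <= J x).
Hypotheses (iG : leb.-integrable Omega (EFin \o G)) (iJ : leb.-integrable Omega (EFin \o J)).
Hypothesis gGJ : forall sigma s : R, 0 < sigma -> 0 < s -> 1 <= ln s^-1 ->
  {ae leb, forall x, Omega x -> forall i,
    `|g i x| <= sigma * (2 + s * G x) + 2 / lam * ln s^-1 / sigma ^+ n.-1 * J x}.
Hypotheses (C1 : 1 <= C) (bC : forall y : R, bump y <= C).

Let mO := open_measurable_rV oO.
Let IG : R := \int[leb]_(x in Omega) G x.

Let IG0 : 0 <= IG.
Proof. by apply: Rintegral_ge0. Qed.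

(** The exponential term is enlarged to all of Omega, its smallness coming from s; only the J-term
    must remain local, for the overlap count. *)
Lemma gradient_integral_le (z : 'rV[R]_n) (s0 sigma s : R) i : 0 <= s0 -> cube z s0 `<=` Omega ->
  0 < sigma -> 0 < s -> 1 <= ln s^-1 ->
  \int[leb]_(x in cube z s0) `|g i x| <=
    sigma * (2 * (2 * s0) ^+ n + s * IG) +
    2 / lam * ln s^-1 / sigma ^+ n.-1 * \int[leb]_(x in cube z s0) J x.
Proof.
move=> s00 zO sg0 s_gt0 ls; set c := 2 / lam * _ / _.
have c0 : 0 <= c.
  by rewrite divr_ge0 ?exprn_ge0 ?(ltW sg0) // mulr_ge0 ?divr_ge0 ?(ltW lam0) // (le_trans _ ls).
have mQ := @measurable_cube _ _ z s0.
have sub v : leb.-integrable Omega (EFin \o v) -> leb.-integrable (cube z s0) (EFin \o v).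
  exact: integrableS.
have iGQ := sub _ iG; have iJQ := sub _ iJ.
have igQ : leb.-integrable (cube z s0) (EFin \o g i) by exact: Lg (@compact_cube _ _ _ _) zO.
have leG : \int[leb]_(x in cube z s0) G x <= IG.
  apply: fine_le; rewrite ?integrable_fin_num //.
  by apply: ge0_subset_integral => //; [have /integrableP[] := iG|move=> x _; rewrite lee_fin].
have icst : leb.-integrable (cube z s0) (EFin \o (fun=> 2)).
  apply/integrableP; split; first exact/measurable_EFinP/measurable_cst.
  rewrite /= integral_cst // [X in (_ * X)%E](lebesgue_cube _ s00).
  by rewrite -EFinM ltry.
have i1 : leb.-integrable (cube z s0) (EFin \o (fun x => s * G x)).
  exact: (integrableZl mQ s iGQ).
have i2 : leb.-integrable (cube z s0) (EFin \o (fun x => 2 + s * G x)).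
  exact: (integrableD mQ icst i1).
have i3 : leb.-integrable (cube z s0) (EFin \o (fun x => sigma * (2 + s * G x))).
  exact: (integrableZl mQ sigma i2).
have i4 : leb.-integrable (cube z s0) (EFin \o (fun x => c * J x)).
  exact: (integrableZl mQ c iJQ).
have i5 : leb.-integrable (cube z s0) (EFin \o (fun x => sigma * (2 + s * G x) + c * J x)).
  exact: (integrableD mQ i3 i4).
have i6 : leb.-integrable (cube z s0) (EFin \o (fun x => `|g i x|)).
  exact: integrable_norm.
apply: (@le_trans _ _ (\int[leb]_(x in cube z s0) (sigma * (2 + s * G x) + c * J x))).
  apply: fine_le; rewrite ?integrable_fin_num //.
  apply: ae_ge0_le_integral => //.
  - by have /integrableP[] := i6.
  - by move=> x _; rewrite lee_fin addr_ge0 // mulr_ge0 ?(ltW sg0) // ?addr_ge0 // mulr_ge0 // ltW.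
  - by have /integrableP[] := i5.
  - apply: filterS (gGJ sg0 s_gt0 ls) => x H Qx.
    by rewrite lee_fin; apply: H; exact: zO.
rewrite RintegralD // !RintegralZl // RintegralD // RintegralZl // Rintegral_cst //.
rewrite [X in fine X](lebesgue_cube _ s00) /= lerD2r ler_wpM2l ?(ltW sg0) // lerD2l.
by rewrite ler_wpM2l // ltW.
Qed.

Lemma avg_diff_energy (p q z : 'rV[R]_n) (r rho s0 kappa sigma s : R) :
  cube z s0 `<=` Omega -> 0 < kappa -> kappa <= r -> kappa <= rho -> 0 <= s0 ->
  (forall i, `|p ord0 i - z ord0 i| + r <= s0) ->
  (forall i, `|q ord0 i - z ord0 i| + rho <= s0) ->
  0 < sigma -> 0 < s -> 1 <= ln s^-1 ->
  `|avg Omega u p r - avg Omega u q rho| <=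
    n%:R * (C / kappa) ^+ n.-1 * (sigma * (2 * (2 * s0) ^+ n + s * IG) +
    2 / lam * ln s^-1 / sigma ^+ n.-1 * \int[leb]_(x in cube z s0) J x).
Proof.
move=> zO k0 kr krho s00 pz qz sg0 s_gt0 ls.
apply: le_trans (avg_diff oO Lu Lg Wg zO k0 kr krho pz qz bC) _.
set B := _ + _ * \int[leb]_(x in _) J x.
apply: (@le_trans _ _ ((C / kappa) ^+ n.-1 * (\sum_(i < n) B))).
  apply: ler_wpM2l; first by rewrite exprn_ge0 // divr_ge0 ?(ltW k0) // (le_trans _ C1).
  by apply: ler_sum => i _; exact: gradient_integral_le.
by rewrite sumr_const card_ord -[B *+ n]mulr_natl mulrA [X in X * B]mulrC.
Qed.

(** * Summation over the scales at one distance t *)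

Section levels.
Variables (t th delta : R).
Hypotheses (t0 : 0 < t) (lt1 : 1 <= ln t^-1) (th0 : 0 < th) (delta0 : 0 < delta).
Let r0 : R := th * t.
Let r0_gt0 : 0 < r0. Proof. exact: mulr_gt0. Qed.

Definition level_radius (j : nat) : R := r0 / (2 ^+ j) ^+ n.

(** The factor (C / kappa)^(n-1) for kappa = rho / 2^n, the smaller of two consecutive radii, with
    rho^(1-n) split off; the leading n counts the partial derivatives. *)
Definition level_const : R := n%:R * (C * 2 ^+ n) ^+ n.-1.
(** [level_err1] collects the terms linear in sigma and is small with delta. [level_err2] is the
    coefficient of the integral of J; it carries ln (1/t) delta^(1-n), and its factor n + 1 is the
    exponent in the choice of s. *)
Definition level_err1 : R := level_const * delta * (2 * 2 ^+ n + t * IG / th ^+ n).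
Definition level_err2 : R := level_const * (2 / lam * n.+1%:R * ln t^-1) / delta ^+ n.-1.

Lemma level_radius_gt0 j : 0 < level_radius j.
Proof. by rewrite divr_gt0 // !exprn_gt0. Qed.

Lemma level_radiusS j : level_radius j.+1 = level_radius j / 2 ^+ n.
Proof.
by rewrite /level_radius exprS exprMn; field; rewrite !expf_neq0.
Qed.

Lemma level_const_ge0 : 0 <= level_const.
Proof. by rewrite mulr_ge0 // exprn_ge0 // mulr_ge0 ?exprn_ge0 // (le_trans _ C1). Qed.

Lemma level_err1_ge0 : 0 <= level_err1.
Proof.
apply: mulr_ge0; first by rewrite mulr_ge0 ?level_const_ge0 ?ltW.
by rewrite addr_ge0 ?mulr_ge0 ?exprn_ge0 ?invr_ge0 ?exprn_ge0 ?(ltW t0) ?(ltW th0).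
Qed.

Lemma level_err2_ge0 : 0 <= level_err2.
Proof.
rewrite divr_ge0 ?exprn_ge0 ?(ltW delta0) // mulr_ge0 ?level_const_ge0 //.
by rewrite !mulr_ge0 ?invr_ge0 ?(ltW lam0) // (le_trans _ lt1).
Qed.

(** [sigma] solves rho sigma = delta / a. The exponent n + 1 in [s] gives s / rho^n = t / (th^n
    a^n): n factors cancel rho^n and one remains, so the exponential term adds at most t IG / th^n
    to the volume term 2 * 2^n. *)
Let level_algebra (a : R) (m := n.-1) (rho := r0 / a ^+ n) (sigma := delta * a ^+ m / r0)
    (s := (t / a ^+ n) ^+ n.+1) : 1 <= a ->
  rho * sigma = delta / a /\
  (rho ^+ m)^-1 * (sigma * (2 * (2 * rho) ^+ n + s * IG)) <=
    delta * (2 * 2 ^+ n + t * IG / th ^+ n) / a.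
Proof.
have nE : n = m.+1 by rewrite /m prednK // (leq_trans _ n2).
move=> a1; have a0 : 0 < a by exact: lt_le_trans a1.
have A0 : 0 < a ^+ m by exact: exprn_gt0.
have rn0 : r0 != 0 by rewrite gt_eqF.
have an0 : a != 0 by rewrite gt_eqF.
have rs : rho * sigma = delta / a.
  rewrite /rho /sigma nE exprS -/m; field.
  by rewrite rn0 an0 gt_eqF.
have rho0 : 0 < rho by rewrite divr_gt0 ?exprn_gt0.
split=> //.
have -> : (rho ^+ m)^-1 * (sigma * (2 * (2 * rho) ^+ n + s * IG)) =
    rho * sigma * (2 * 2 ^+ n + s / rho ^+ n * IG).
  have rn : rho ^+ n = rho * rho ^+ m by rewrite {1}nE exprS.
  have -> : (2 * rho) ^+ n = 2 ^+ n * (rho * rho ^+ m) by rewrite exprMn rn.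
  have rm0 : rho ^+ m != 0 by rewrite gt_eqF ?exprn_gt0.
  move: (gt_eqF rho0) => /negbT; rewrite rn; move: rm0.
  move: (rho ^+ m) (rho) (2 ^+ n) (sigma) (s) => w v k sg s' w0 v0; field.
  by rewrite v0 w0.
have d0 : 0 <= delta / a by rewrite divr_ge0 // ltW.
rewrite rs [leRHS]mulrAC ler_wpM2l // lerD2l.
have -> : s / rho ^+ n = t / th ^+ n / a ^+ n.
  rewrite /s /rho /r0 !expr_div_n exprMn !exprSr; field.
  by rewrite !gt_eqF ?exprn_gt0.
rewrite mulrAC [leRHS]mulrAC ler_pdivrMr ?exprn_gt0 //.
by rewrite ler_peMr ?exprn_ege1 // mulr_ge0 // divr_ge0 ?exprn_ge0 // ltW.
Qed.

Lemma level_diff (p : 'rV[R]_n) j : cube p (level_radius j) `<=` Omega ->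
  `|avg Omega u p (level_radius j) - avg Omega u p (level_radius j.+1)| <=
    level_err1 / 2 ^+ j +
    level_err2 * ((n * j)%:R + 1) * (2 ^+ j) ^+ n.-1 * \int[leb]_(x in cube p (level_radius j)) J x.
Proof.
move=> pO; set a : R := 2 ^+ j; set rho := level_radius j.
have a1 : 1 <= a by rewrite exprn_ege1 // ler1n.
have a0 : 0 < a by exact: lt_le_trans a1.
have rho0 : 0 < rho := level_radius_gt0 j.
pose sigma := delta * a ^+ n.-1 / r0; pose s := (t / a ^+ n) ^+ n.+1.
have sg0 : 0 < sigma by rewrite divr_gt0 // mulr_gt0 // exprn_gt0.
have s0 : 0 < s by rewrite exprn_gt0 // divr_gt0 // exprn_gt0.
have lnsE : ln s^-1 = n.+1%:R * ((n * j)%:R * ln 2 + ln t^-1).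
  rewrite /s -exprVn lnXn ?invr_gt0 ?divr_gt0 ?exprn_gt0 // mulr_natl; congr (_ *+ _).
  rewrite invf_div lnM ?posrE ?invr_gt0 ?exprn_gt0 //; congr (_ + _).
  by rewrite /a -exprM mulnC lnXn // mulr_natl.
have ln2 : 0 <= ln 2 :> R by rewrite ln_ge0 // ler1n.
have ln2le : ln 2 <= 1 :> R.
  by have := @le_ln1Dx R 1 _; rewrite (_ : 1 + 1 = 2 :> R) //; apply; lra.
(* As ln 2 <= 1 <= ln (1/t), the dependence on the level is absorbed into the factor nj + 1. *)
have lns_le : ln s^-1 <= n.+1%:R * ((n * j)%:R + 1) * ln t^-1.
  rewrite lnsE -mulrA ler_wpM2l // mulrDl mul1r lerD2r ler_wpM2l //.
  exact: le_trans ln2le lt1.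
have ls : 1 <= ln s^-1.
  rewrite lnsE -[leLHS]mul1r ler_pM ?ler1n //.
  by rewrite -[leLHS]add0r lerD // mulr_ge0.
have rS : level_radius j.+1 <= rho.
  by rewrite level_radiusS ler_pdivrMr ?exprn_gt0 // ler_peMr ?(ltW rho0) // exprn_ege1 // ler1n.
have pp (r' : R) : r' <= rho -> forall i, `|p ord0 i - p ord0 i| + r' <= rho.
  by move=> r'rho i; rewrite subrr normr0 add0r.
have [rs alg] := level_algebra a1.
have H := avg_diff_energy pO (level_radius_gt0 j.+1) rS (lexx _) (ltW rho0)
  (pp _ (lexx _)) (pp _ rS) sg0 s0 ls.
apply: le_trans H _; rewrite level_radiusS -/rho.
set IJ := \int[leb]_(x in _) J x.
have IJ0 : 0 <= IJ by exact: Rintegral_ge0.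
have -> : n%:R * (C / (rho / 2 ^+ n)) ^+ n.-1 = level_const * (rho ^+ n.-1)^-1.
  rewrite /level_const -mulrA; congr (_ * _).
  by rewrite invf_div mulrA expr_div_n.
rewrite -mulrA mulrDr mulrDr; apply: lerD.
  rewrite /level_err1 -mulrA -mulrA ler_wpM2l ?level_const_ge0 //.
  by rewrite [leRHS]mulrA.
rewrite /level_err2.
have -> : (rho ^+ n.-1)^-1 * (2 / lam * ln s^-1 / sigma ^+ n.-1 * IJ) =
    2 / lam * ln s^-1 * (a ^+ n.-1 / delta ^+ n.-1) * IJ.
  have -> : a ^+ n.-1 / delta ^+ n.-1 = (rho ^+ n.-1 * sigma ^+ n.-1)^-1.
    by rewrite -expr_div_n -[a / delta]invf_div -rs exprVn exprMn.
  have : rho ^+ n.-1 != 0 by rewrite gt_eqF // exprn_gt0.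
  have : sigma ^+ n.-1 != 0 by rewrite gt_eqF // exprn_gt0.
  move: (rho ^+ _) (sigma ^+ _) (ln _) IJ {IJ0} => v w l I w0 v0; field.
  by rewrite v0 w0 gt_eqF.
rewrite mulrA ler_wpM2r //.
have -> : level_const * (2 / lam * n.+1%:R * ln t^-1) / delta ^+ n.-1 * ((n * j)%:R + 1) * a ^+ n.-1
   = level_const * (2 / lam * (n.+1%:R * ((n * j)%:R + 1) * ln t^-1) * (a ^+ n.-1 / delta ^+ n.-1)).
  by field; rewrite !gt_eqF ?exprn_gt0.
apply: ler_wpM2l; first exact: level_const_ge0.
apply: ler_wpM2r; first by rewrite divr_ge0 ?exprn_ge0 ?ltW.
by apply: ler_wpM2l => //; rewrite divr_ge0 // ltW.
Qed.

Lemma sum_geom_lt2 (L : nat) : \sum_(j < L) (2 ^+ j)^-1 <= 2 :> R.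
Proof.
suff -> : \sum_(j < L) (2 ^+ j)^-1 = 2 - 2 / 2 ^+ L :> R.
  by rewrite gerBl divr_ge0 // exprn_ge0.
elim: L => [|L IH]; first by rewrite big_ord0 expr0; lra.
by rewrite big_ord_recr /= IH exprS; field; rewrite expf_neq0.
Qed.

Lemma sum_arith_geom (m L : nat) :
  \sum_(j < L) ((m * j)%:R + 1) / 2 ^+ j <= 2 + 2 * m%:R :> R.
Proof.
suff -> : \sum_(j < L) ((m * j)%:R + 1) / 2 ^+ j =
    2 + 2 * m%:R - (2 + 2 * m%:R + 2 * (m * L)%:R) / 2 ^+ L :> R.
  by rewrite gerBl divr_ge0 ?exprn_ge0 // !addr_ge0 // mulr_ge0.
elim: L => [|L IH]; first by rewrite big_ord0 expr0 muln0; lra.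
rewrite big_ord_recr /= IH exprS mulnS natrD; field; rewrite expf_neq0 //.
Qed.

(* Average the telescoped oscillation over N points whose i-th coordinates are
   equally spaced: a cube of radius rho contains only about N rho / D0 of them,
   which beats the growth of the level estimates. *)
Lemma curve_point (U K : set 'rV[R]_n) (i : 'I_n) (al D0 a eps : R) :
  measurable U -> U `<=` Omega -> compact K ->
  (forall x, Omega x -> {for x, continuous u}) ->
  0 < D0 -> 0 < eps ->
  (forall v, al <= v <= al + D0 -> exists2 p, K p & p ord0 i = v) ->
  (forall p, K p -> cube p r0 `<=` U) ->
  (forall p, K p -> `|u p - a| <= eps) ->
  exists2 p, K p & `|avg Omega u p r0 - a| <=
    2 * eps + 2 * level_err1 +
    level_err2 * (2 + 2 * n%:R) * (2 * r0 / D0 + 1) * \int[leb]_(x in U) J x.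
Proof.
move=> mU UO cK cu D00 eps0 Kv KU Ka.
have selfcube p (r : R) : 0 <= r -> cube p r p by move=> rr i'; rewrite subrr normr0.
(* Uniform continuity of u around the compact K, so that a single last level L serves all its
   points. *)
have [L HL] : exists L : nat, forall p, K p -> forall y, cube p (r0 / 2 ^+ L) y -> `|u y - u p| <= eps.
  have near_eps : \forall e \near 0^'+, K `<=` [set p | forall y, cube p e y -> `|u y - u p| <= eps].
    apply: (compact_near_coveringP K).1 => // x Kx.
    have Ox : Omega x by apply/UO/(KU x Kx)/selfcube/ltW.
    have : \forall y \near x, `|u y - u x| <= eps / 2.
      have /cvgrPdist_le := cu _ Ox; move=> /(_ (eps / 2)); rewrite divr_gt0 // => /(_ isT).
      by apply: filterS => y; rewrite distrC.
    move=> /nbhs_cube_ex[r r_gt0 xr].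
    exists (cube x (r / 2), [set e : R | 0 < e < r / 2]) => /=.
      split; first by apply: nbhs_cube; rewrite divr_gt0.
      near=> e; apply/andP; split; near: e; first exact: nbhs_right_gt.
      by apply: nbhs_right_lt; rewrite divr_gt0.
    move=> [p e] /= [xp /andP[e0 er]] y py.
    have xy : cube x r y.
      by move=> i'; have := ler_distD (p ord0 i') (y ord0 i') (x ord0 i'); have := xp i'; have := py i'; lra.
    have xp' : cube x r p by move=> i'; have := xp i'; lra.
    have := xr _ xy; have := xr _ xp' => /=.
    have := ler_distD (u x) (u y) (u p); rewrite (distrC (u x) (u p)); lra.
  have [e /= e0 He] := near_eps.
  pose e1 : {posnum R} := PosNum (divr_gt0 e0 r0_gt0).
  have [L _ HL] := near_infty_natSinv_expn_lt e1.
  exists L => p Kp y py; have := HL L (leqnn L) => /=; rewrite ltr_pdivlMr // => Le.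
  have L0 : 0 < r0 / 2 ^+ L by rewrite divr_gt0 // exprn_gt0.
  apply: (He (r0 / 2 ^+ L)) Kp y py => //.
  by rewrite /= sub0r normrN gtr0_norm // (le_lt_trans _ Le) // mul1r mulrC.
(* Enough points that N / (2^j)^n >= 1 for every level j < L; this absorbs the additive 1 of the
   progression count. *)
pose N := ((2 ^ L) ^ n)%N.
have NE : N%:R = (2 ^+ L) ^+ n :> R by rewrite !natrX.
have N0 : 0 < N%:R :> R by rewrite NE !exprn_gt0.
pose dl := D0 / N%:R.
have dl0 : 0 < dl by rewrite divr_gt0.
have pts (b : 'I_N) : exists p, K p /\ p ord0 i = al + b%:R * dl.
  have [|p Kp pv] := Kv (al + b%:R * dl); last by exists p.
  have b0 : 0 <= b%:R * dl by rewrite mulr_ge0 // ltW.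
  have : b%:R * dl <= D0.
    by rewrite /dl mulrCA ger_pMr // ler_pdivrMr // mul1r ler_nat ltnW.
  lra.
have [P HP] := choice pts.
have PK b : K (P b) by have [] := HP b.
set IJ := \int[leb]_(x in U) J x; set B := _ + _ * IJ.
have mOJ : measurable_fun U J.
  have /integrableP[/measurable_EFinP mJ _] := iJ.
  exact: measurable_funS mJ.
have iJS S : measurable S -> S `<=` Omega -> leb.-integrable S (EFin \o J).
  by move=> mS SO; exact: integrableS iJ.
have subU b j : cube (P b) (level_radius j) `<=` U.
  apply: subset_trans (KU _ (PK b)); apply: cube_subset => i'.
  rewrite subrr normr0 add0r ler_pdivrMr ?exprn_gt0 // ler_peMr ?(ltW r0_gt0) //.
  by rewrite exprn_ege1 // exprn_ege1 // ler1n.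
have count j : (j < L)%N -> \sum_(b < N) \int[leb]_(x in cube (P b) (level_radius j)) J x <=
    N%:R * ((2 * r0 / D0 + 1) / (2 ^+ j) ^+ n) * IJ.
  move=> jL.
  have radE : 2 * level_radius j / dl = N%:R * (2 * r0 / D0 / (2 ^+ j) ^+ n).
    by rewrite /dl /level_radius; field; rewrite !gt_eqF ?exprn_gt0.
  have le1 : 1 <= N%:R / (2 ^+ j) ^+ n :> R.
    rewrite ler_pdivlMr ?exprn_gt0 // mul1r NE lerXn2r ?nnegrE ?exprn_ge0 //.
    by rewrite ler_eXn2l ?ltr1n // ltnW.
  have M0 : 0 <= 2 * level_radius j / dl + 1.
    by rewrite addr_ge0 // divr_ge0 ?mulr_ge0 ?(ltW dl0) // ltW // level_radius_gt0.
  apply: (@le_trans _ _ ((2 * level_radius j / dl + 1) * IJ)); last first.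
    rewrite ler_wpM2r ?Rintegral_ge0 // radE.
    by rewrite [X in _ <= _ * X]mulrDl mul1r mulrDr lerD2l.
  rewrite -lee_fin -sumEFin EFinM.
  have finJ S : measurable S -> S `<=` Omega ->
      (\int[leb]_(x in S) J x)%:E = (\int[leb]_(x in S) (J x)%:E)%E.
    by move=> mS SO; rewrite /Rintegral fineK //; apply: integrable_fin_num => //; exact: iJS.
  rewrite [X in (_ * X)%E]finJ //.
  rewrite (eq_bigr _ (fun b _ => finJ _ (@measurable_cube _ _ _ _) (subset_trans (subU b j) UO))).
  apply: sum_integral_overlap => //.
    by move=> b; exact: measurable_cube.
  move=> x Ux.
  apply: le_trans (@card_near_progression _ N (x ord0 i) al dl _ dl0 (ltW (level_radius_gt0 j))).
  rewrite ler_nat; apply/subset_leq_card/fintype.subsetP => b; rewrite !inE => bx.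
  by have := bx i; have [_ ->] := HP b.
(* The averaging argument by contradiction: if every [P b] failed, the sum of the N strict
   inequalities [big] would violate the bounds [count]. *)
apply: contrapT => noP.
have big (b : 'I_N) : B < 2 * eps + \sum_(j < L)
    (level_err1 / 2 ^+ j + level_err2 * ((n * j)%:R + 1) * (2 ^+ j) ^+ n.-1 *
      \int[leb]_(x in cube (P b) (level_radius j)) J x).
  rewrite ltNge; apply/negP => leB; apply: noP; exists (P b) => //.
  apply: le_trans leB.
  have last : `|avg Omega u (P b) (level_radius L) - a| <= 2 * eps.
    apply: avg_near => //; first exact: subset_trans (subU b L) UO.
      exact: level_radius_gt0.
    move=> y Py; have := ler_distD (u (P b)) (u y) a; have := Ka _ (PK b).
    suff : `|u y - u (P b)| <= eps by lra.
    apply: HL => //; apply: cube_subset Py => i'; rewrite subrr normr0 add0r.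
    rewrite /level_radius ler_wpM2l ?(ltW r0_gt0) // lef_pV2 ?posrE ?exprn_gt0 //.
    by rewrite -exprM ler_eXn2l ?ltr1n // leq_pmulr // (leq_trans _ n2).
  have lvl0 : level_radius 0 = r0 by rewrite /level_radius expr0 expr1n divr1.
  rewrite -{1}lvl0.
  apply: le_trans (ler_distD (avg Omega u (P b) (level_radius L)) _ _) _.
  rewrite addrC lerD //.
  have -> : avg Omega u (P b) (level_radius 0) - avg Omega u (P b) (level_radius L) =
    \sum_(j < L) (avg Omega u (P b) (level_radius j) - avg Omega u (P b) (level_radius j.+1)).
    exact: (telescope_ord (fun j => avg Omega u (P b) (level_radius j)) L).
  apply: le_trans (ler_norm_sum _ _ _) _; apply: ler_sum => j _.
  apply: level_diff; exact: subset_trans (subU b j) UO.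
have := @ltr_sum R 'I_N (index_enum _) xpredT (fun=> B) _ _ (fun b _ => big b).
have -> : has xpredT (index_enum 'I_N).
  have N0' : (0 < N)%N by rewrite /N !expn_gt0.
  by apply/hasP; exists (Ordinal N0'); rewrite ?mem_index_enum.
move=> /(_ isT); rewrite sumr_const card_ord big_split /= sumr_const card_ord.
rewrite exchange_big /= -[B *+ N]mulr_natl -[(2 * eps) *+ N]mulr_natl => lt.
suff : \sum_(j < L) \sum_(b < N) (level_err1 / 2 ^+ j + level_err2 * ((n * j)%:R + 1) * (2 ^+ j) ^+ n.-1 *
      \int[leb]_(x in cube (P b) (level_radius j)) J x) <=
    N%:R * (2 * level_err1 + level_err2 * (2 + 2 * n%:R) * (2 * r0 / D0 + 1) * IJ).
  move=> le; have := lt_le_trans lt (lerD (lexx _) le); rewrite -mulrDr ltr_pM2l //.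
  by rewrite /B addrA ltxx.
have IJ0 : 0 <= IJ by exact: Rintegral_ge0.
have cst0 : 0 <= 2 * r0 / D0 + 1.
  by rewrite addr_ge0 // divr_ge0 ?mulr_ge0 // ltW.
apply: (@le_trans _ _ (\sum_(j < L) N%:R * (level_err1 * (2 ^+ j)^-1 +
    level_err2 * (2 * r0 / D0 + 1) * IJ * (((n * j)%:R + 1) / 2 ^+ j)))).
  apply: ler_sum => j _; rewrite big_split /= sumr_const card_ord -[(level_err1 / _) *+ N]mulr_natl [leRHS]mulrDr lerD2l.
  rewrite -mulr_sumr.
  have w0 : 0 <= level_err2 * ((n * j)%:R + 1) * (2 ^+ j) ^+ n.-1.
    by rewrite mulr_ge0 ?exprn_ge0 // mulr_ge0 ?level_err2_ge0 // addr_ge0.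
  apply: le_trans (ler_wpM2l w0 (count j (ltn_ord j))) _.
  have nE : n = n.-1.+1 by rewrite prednK // (leq_trans _ n2).
  rewrite {3}nE exprS le_eqVlt; apply/orP; left; apply/eqP.
  have aj : 2 ^+ j != 0 :> R by rewrite expf_neq0.
  have am : (2 ^+ j) ^+ n.-1 != 0 :> R by rewrite expf_neq0.
  move: aj am; move: (2 ^+ j) ((2 ^+ j) ^+ n.-1) => w v w_0 v_0.
  by field; rewrite w_0 v_0 gt_eqF.
rewrite -mulr_sumr ler_wpM2l // big_split /= -!mulr_sumr lerD //.
  by rewrite mulrC ler_wpM2r ?level_err1_ge0 // sum_geom_lt2.
have -> : level_err2 * (2 + 2 * n%:R) * (2 * r0 / D0 + 1) * IJ =
  level_err2 * (2 * r0 / D0 + 1) * IJ * (2 + 2 * n%:R).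
  by move: level_err2 (2 * r0 / D0 + 1) => x y; ring.
by rewrite ler_wpM2l ?sum_arith_geom // mulr_ge0 // mulr_ge0 // level_err2_ge0.
Unshelve. all: by end_near.
Qed.

(** Only one scale is involved, so sigma = delta / r0 and s = t^(n+1) need no decay. Both bumps live
    in the cube of radius 2 r0, and the doubled radius costs the factor 2^n in the volume term. *)
Lemma neighbor_diff (U : set 'rV[R]_n) (z z' : 'rV[R]_n) :
  measurable U -> U `<=` Omega -> cube z (2 * r0) `<=` U ->
  (forall i, `|z' ord0 i - z ord0 i| <= r0) ->
  `|avg Omega u z r0 - avg Omega u z' r0| <=
    2 ^+ n * level_err1 + level_err2 * \int[leb]_(x in U) J x.
Proof.
move=> mU UO zU zz'.
pose sigma := delta / r0; pose s := t ^+ n.+1.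
have sg0 : 0 < sigma by rewrite divr_gt0.
have s0 : 0 < s by rewrite exprn_gt0.
have lnsE : ln s^-1 = n.+1%:R * ln t^-1 by rewrite /s -exprVn lnXn ?invr_gt0 // mulr_natl.
have ls : 1 <= ln s^-1 by rewrite lnsE -[leLHS]mul1r ler_pM ?ler1n.
have r20 : 0 <= 2 * r0 by rewrite mulr_ge0 // ltW.
have hz i : `|z ord0 i - z ord0 i| + r0 <= 2 * r0.
  by rewrite subrr normr0 add0r; have := ltW r0_gt0; lra.
have hz' i : `|z' ord0 i - z ord0 i| + r0 <= 2 * r0 by have := zz' i; lra.
have H := avg_diff_energy (subset_trans zU UO) r0_gt0 (lexx _) (lexx _) r20 hz hz' sg0 s0 ls.
apply: le_trans H _.
set I1 := \int[leb]_(x in cube _ _) J x; set I2 := \int[leb]_(x in U) J x.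
have I12 : I1 <= I2.
  have iJS S : measurable S -> S `<=` Omega -> leb.-integrable S (EFin \o J).
    by move=> mS SO; exact: integrableS iJ.
  have iJU := iJS _ mU UO.
  have iJc := iJS _ (@measurable_cube _ _ z (2 * r0)) (subset_trans zU UO).
  apply: fine_le; rewrite ?integrable_fin_num //; try exact: measurable_cube.
  apply: ge0_subset_integral => //; first exact: measurable_cube.
    by have /integrableP[] := iJU.
  by move=> x _; rewrite lee_fin.
have I10 : 0 <= I1 by exact: Rintegral_ge0.
have nE : n = n.-1.+1 by rewrite prednK // (leq_trans _ n2).
have CC : n%:R * (C / r0) ^+ n.-1 * r0 ^+ n.-1 <= level_const.
  rewrite -mulrA -exprMn divfK ?gt_eqF // /level_const ler_wpM2l //.
  rewrite lerXn2r ?nnegrE ?mulr_ge0 ?exprn_ge0 ?(le_trans _ C1) //.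
  by rewrite ler_peMr ?(le_trans _ C1) // exprn_ege1 // ler1n.
have C0 : 0 <= n%:R * (C / r0) ^+ n.-1.
  by rewrite mulr_ge0 // exprn_ge0 // divr_ge0 ?(ltW r0_gt0) // (le_trans _ C1).
have rm0 : 0 < r0 ^+ n.-1 by rewrite exprn_gt0.
have th_n : 0 < th ^+ n by rewrite exprn_gt0.
rewrite mulrDr; apply: lerD.
  have -> : sigma * (2 * (2 * (2 * r0)) ^+ n + s * IG) =
      r0 ^+ n.-1 * (delta * (2 * 2 ^+ n * 2 ^+ n + t * IG / th ^+ n)).
    have -> : s = t * (r0 ^+ n / th ^+ n).
      by rewrite /s exprS /r0 exprMn [th ^+ n * _]mulrC mulfK // gt_eqF.
    have -> : (2 * (2 * r0)) ^+ n = 2 ^+ n * 2 ^+ n * r0 ^+ n.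
      by rewrite mulrA exprMn [(2 * 2) ^+ n]exprMn.
    have -> : r0 ^+ n = r0 * r0 ^+ n.-1 by rewrite {1}nE exprS.
    move: (r0_gt0) th_n rm0; rewrite /sigma.
    move: (r0) (th ^+ n) (r0 ^+ n.-1) (2 ^+ n) => x y z0 w x0 y0 z00; field.
    by rewrite !gt_eqF.
  rewrite mulrA; apply: le_trans (ler_wpM2r _ CC) _; first rewrite mulr_ge0 ?(ltW delta0) // addr_ge0 ?mulr_ge0 ?exprn_ge0 //.
      by rewrite ltW.
    by rewrite invr_ge0 ltW.
  rewrite /level_err1; set X := t * IG / th ^+ n.
  have X0 : 0 <= X by rewrite divr_ge0 ?(ltW th_n) // mulr_ge0 // ltW.
  have -> : 2 ^+ n * (level_const * delta * (2 * 2 ^+ n + X)) =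
      level_const * (delta * (2 * 2 ^+ n * 2 ^+ n + 2 ^+ n * X)).
    by move: level_const (2 ^+ n) => x y; ring.
  rewrite ler_wpM2l ?level_const_ge0 // ler_wpM2l ?(ltW delta0) // lerD2l.
  by rewrite ler_peMl // exprn_ege1 // ler1n.
have -> : n%:R * (C / r0) ^+ n.-1 * (2 / lam * ln s^-1 / sigma ^+ n.-1 * I1) =
    n%:R * (C / r0) ^+ n.-1 * r0 ^+ n.-1 * (2 / lam * n.+1%:R * ln t^-1 / delta ^+ n.-1) * I1.
  have -> : sigma ^+ n.-1 = delta ^+ n.-1 / r0 ^+ n.-1 by rewrite /sigma expr_div_n.
  have dm0 : 0 < delta ^+ n.-1 by exact: exprn_gt0.
  rewrite lnsE; move: dm0 rm0.
  move: (delta ^+ _) (r0 ^+ _) (ln _) ((C / r0) ^+ _) => x y l w x0 y0; field.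
  by rewrite !gt_eqF.
apply: ler_pM => //.
  rewrite mulr_ge0 //; first by rewrite mulr_ge0 // ltW.
  by rewrite divr_ge0 ?exprn_ge0 ?(ltW delta0) // !mulr_ge0 ?invr_ge0 ?(ltW lam0) // (le_trans _ lt1).
rewrite /level_err2 -[leRHS]mulrA ler_wpM2r //.
by rewrite divr_ge0 ?exprn_ge0 ?(ltW delta0) // !mulr_ge0 ?invr_ge0 ?(ltW lam0) // (le_trans _ lt1).
Qed.

End levels.

(** * Geometry near a boundary point at distance t *)

Section scale.
Hypothesis cu : forall x, Omega x -> {for x, continuous u}.
Variables (c0 c' t delta eps : R) (xi x0 : 'rV[R]_n).
Hypotheses (c00 : 0 < c0) (c'0 : 0 < c') (t0 : 0 < t) (lt1 : 1 <= ln t^-1).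
Hypotheses (delta0 : 0 < delta) (eps0 : 0 < eps) (bxi : boundary Omega xi).

Let N : R := n%:R.
(** The John condition is Euclidean while cubes are sup-norm balls: Euclidean distance s / c0 to the
    boundary means sup distance at least q s. [w] is such that N c' w < 1, which is what a
    contradiction with the uniformity condition needs, and [scale_ratio] is fixed by 2 r0 = d0 w /
    4. *)
Let q : R := (c0 * N)^-1.
Let w : R := (N * (1 + c'))^-1.
Let d0 : R := q ^+ 2 * t / 8.

Definition scale_ratio : R := q ^+ 2 * w / 64.
(** In the radius, t accounts for the distance from xi to the chosen curve point, 2 N c' t for the
    length of the uniformity curve, and another t for the cubes of radius 2 r0. *)
Definition scale_nbhd : set 'rV[R]_n := Omega `&` cube xi ((2 + 2 * N * c') * t).

Let th := scale_ratio.
Let U := scale_nbhd.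
Let r0 : R := th * t.

Let N1 : 1 <= N.
Proof. by rewrite ler1n (leq_trans _ n2). Qed.

Let N0 : 0 < N.
Proof. exact: lt_le_trans N1. Qed.

Let q0 : 0 < q.
Proof. by rewrite invr_gt0 mulr_gt0. Qed.

Let w0 : 0 < w.
Proof. by rewrite invr_gt0 mulr_gt0 // addr_gt0. Qed.

Let w1 : w <= 1.
Proof. by rewrite invf_le1 ?mulr_gt0 ?addr_gt0 // mulr_ege1 // lerDl ltW. Qed.

Let th0 : 0 < th.
Proof. by rewrite /th /scale_ratio divr_gt0 // mulr_gt0 // exprn_gt0. Qed.

Let r00 : 0 < r0.
Proof. exact: mulr_gt0. Qed.

Let d00 : 0 < d0.
Proof. by rewrite /d0 divr_gt0 // mulr_gt0 // exprn_gt0. Qed.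

Let r0E : 2 * r0 = d0 * w / 4.
Proof. by rewrite /r0 /th /scale_ratio /d0; field. Qed.

Let r0d0 : 2 * r0 <= d0 / 4.
Proof. by rewrite r0E ler_pM2r ?invr_gt0 // ler_piMr // ltW. Qed.

Let mU : measurable U.
Proof. by apply: measurableI; [exact: open_measurable_rV|exact: measurable_cube]. Qed.

Let UO : U `<=` Omega.
Proof. exact: subIsetl. Qed.

(** The bound of [curve_point] for D0 = q t / 2, where 2 r0 / D0 = 4 [scale_ratio] / q. *)
Definition curve_bound : R :=
  2 * eps + 2 * level_err1 t th delta +
  level_err2 t delta * (2 + 2 * n%:R) * (4 * scale_ratio / q + 1) * \int[leb]_(x in U) J x.

Section one_curve.
Variables (l a : R) (gamma : R -> 'rV[R]_n).
Hypotheses (Jg : boundary_John_curve Omega c0 x0 xi l gamma) (tl : t <= l).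

Let ag : arclength_param l gamma. Proof. by case: Jg. Qed.

Let curve_near (s : R) i : 0 <= s <= l -> `|gamma s ord0 i - xi ord0 i| <= s.
Proof.
move=> sl; have [_ <- _ _ _] := Jg; have /andP[s0 _] := sl.
have z0 : 0 <= (0 : R) <= l by rewrite lexx (le_trans s0) //; case/andP: sl.
by have := arclength_coord_lipschitz i ag sl z0; rewrite subr0 (ger0_norm s0).
Qed.

Let curve_dist (s : R) y : 0 <= s <= l -> boundary Omega y -> s / c0 <= enorm (gamma s - y).
Proof.
by move=> sl Oy; have [_ _ _ _ H] := Jg; apply: le_trans (H s sl) (edist_set_le _ Oy).
Qed.

Let tl0 : 0 <= t <= l. Proof. by rewrite tl ltW. Qed.

(** The John condition at xi itself forces this: gamma t has distance at least t / c0 from xi, but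
    at most N t. *)
Lemma John_const_le1 : q <= 1.
Proof.
have := enorm_le_coord (x := gamma t - xi) (ltW t0).
have near i : `|(gamma t - xi) ord0 i| <= t by rewrite !mxE; exact: curve_near.
move=> /(_ near)/(le_trans (curve_dist tl0 bxi)); rewrite ler_pdivrMr //.
by rewrite -mulrA mulrCA -[leLHS]mulr1 ler_pM2l // mulrC invf_le1 // mulr_gt0.
Qed.

(** Small enough that gamma s1 is still within q t / 4 of xi, which leaves the curve a definite
    coordinate spread up to parameter t; large enough that from s1 on the sup distance to the
    boundary is at least q s1 = 2 d0. *)
Let s1 : R := q * t / 4.

Let s10 : 0 < s1.
Proof. by rewrite /s1 divr_gt0 // mulr_gt0. Qed.

Let s1t : s1 <= t.
Proof.
have qt : q * t <= t by rewrite ler_piMl ?(ltW t0) // John_const_le1.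
by rewrite /s1; move: t0; lra.
Qed.

Lemma John_curve_free (s : R) y : s1 <= s <= t -> boundary Omega y -> ~ cube (gamma s) d0 y.
Proof.
move=> /andP[ss st] Oy cy.
have sl : 0 <= s <= l by rewrite (le_trans (ltW s10)) // (le_trans st).
have := enorm_le_coord (x := gamma s - y) (ltW d00).
have near i : `|(gamma s - y) ord0 i| <= d0 by rewrite !mxE distrC; exact: cy.
move=> /(_ near)/(le_trans (curve_dist sl Oy)).
have -> : N * d0 = s1 / c0 / 2 by rewrite /s1 /d0 /q; field; rewrite !gt_eqF.
have : s1 / c0 <= s / c0 by rewrite ler_pM2r ?invr_gt0.
have : 0 < s1 / c0 by rewrite divr_gt0.
lra.
Qed.

Lemma John_curve_cube (s : R) : s1 <= s <= t -> cube (gamma s) d0 `<=` Omega.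
Proof.
move=> sst; apply: cube_sub_domain => //; last by move=> y Oy; exact: John_curve_free.
  have [_ _ _ H _] := Jg; case/andP: sst => ss st; apply: H.
  by rewrite (lt_le_trans s10) // (le_trans st).
exact: ltW.
Qed.

Lemma John_curve_near (s : R) i : s1 <= s <= t -> `|gamma s ord0 i - xi ord0 i| <= t.
Proof.
move=> /andP[ss st]; apply: le_trans (st); apply: curve_near.
by rewrite (le_trans (ltW s10)) //= (le_trans st).
Qed.

Lemma curve_side : (forall s : R, 0 < s <= t -> `|u (gamma s) - a| <= eps) ->
  exists2 s : R, s1 <= s <= t & `|avg Omega u (gamma s) r0 - a| <= curve_bound.
Proof.
move=> ua.
(* The Euclidean distance from gamma t to xi is at least t / c0 = N q t, so some coordinate differs
   by at least q t. The constant 3/4 gives a strict inequality and still leaves q t / 2 after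
   subtracting s1. *)
have [i far] : exists i, 3 / 4 * (q * t) < `|gamma t ord0 i - xi ord0 i|.
  apply: contrapT => H.
  have qt0 : 0 <= 3 / 4 * (q * t) by rewrite mulr_ge0 // mulr_ge0 // ltW.
  have := enorm_le_coord (x := gamma t - xi) qt0.
  have near i : `|(gamma t - xi) ord0 i| <= 3 / 4 * (q * t).
    by rewrite !mxE leNgt; apply/negP => h; apply: H; exists i.
  move=> /(_ near)/(le_trans (curve_dist tl0 bxi)).
  have -> : N * (3 / 4 * (q * t)) = 3 / 4 * (t / c0) by rewrite /q; field; rewrite !gt_eqF.
  have : 0 < t / c0 by rewrite divr_gt0.
  lra.
pose v1 : R := gamma s1 ord0 i; pose v2 : R := gamma t ord0 i.
have v12 : q * t / 2 <= `|v2 - v1|.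
  have s1l : 0 <= s1 <= l by rewrite (ltW s10) (le_trans s1t).
  have := ler_distD v1 v2 (xi ord0 i); have := curve_near i s1l; rewrite -/v1.
  by move: far; rewrite -/v2 /s1; lra.
pose K := gamma @` `[s1, t]%classic.
have cg : {within `[s1, t], continuous gamma}.
  apply: continuous_subspaceW (arclength_continuous ag) => s /=.
  by rewrite !in_itv /= => /andP[ss st]; rewrite (le_trans (ltW s10)) //= (le_trans st).
have cgi : {within `[s1, t], continuous (fun s => gamma s ord0 i)}.
  apply/subspace_continuousP => s sst.
  have h := (subspace_continuousP _ _).1 cg s sst.
  exact: (continuous_cvg _ (@coord_continuous _ _ _ _ _ _) h).
have cK : compact K by apply: continuous_compact => //; exact: segment_compact.
have Dgt : 0 < q * t / 2 by rewrite divr_gt0 // mulr_gt0.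
have Kv v : Num.min v1 v2 <= v <= Num.min v1 v2 + q * t / 2 ->
    exists2 p, K p & p ord0 i = v.
  move=> /andP[mv vM].
  have [|s] := @IVT R (fun s => gamma s ord0 i) s1 t v s1t cgi.
    rewrite -/v1 -/v2 mv /= (le_trans vM) //.
    rewrite minEle maxEle; move: v12; have [h|h] := leP v1 v2 => v12.
      by move: v12; rewrite ger0_norm ?subr_ge0 //; lra.
    by move: v12; rewrite ltr0_norm ?subr_lt0 //; lra.
  by move=> sst sv; exists (gamma s) => //; exists s.
have KU p : K p -> cube p (th * t) `<=` U.
  move=> [s /= + <-]; rewrite in_itv /= => sst.
  rewrite subsetI; split.
    apply: subset_trans (John_curve_cube sst); apply: cube_subset => j.
    rewrite subrr normr0 add0r; have := ltW r00; have := ltW d00; have := r0d0.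
    by rewrite -/r0; lra.
  apply: cube_subset => j.
  have q2t : q ^+ 2 * t <= t.
    by rewrite ler_piMl ?(ltW t0) // exprn_ile1 // ?John_const_le1 // ltW.
  have : 0 <= 2 * N * c' * t by rewrite !mulr_ge0 // ltW.
  have := John_curve_near j sst; move: r0d0 q2t; rewrite -/r0 /d0.
  by have := ltW r00; have := ltW t0; lra.
have Ka p : K p -> `|u p - a| <= eps.
  move=> [s /= + <-]; rewrite in_itv /= => /andP[ss st]; apply: ua.
  by rewrite (lt_le_trans s10).
have [p [s /= + <-] H] := curve_point t0 lt1 th0 delta0 mU UO cK cu Dgt eps0 Kv KU Ka.
rewrite in_itv /= => sst; exists s => //.
move: H; rewrite /curve_bound.
suff -> : 2 * (th * t) / (q * t / 2) = 4 * scale_ratio / q by [].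
by rewrite /th; field; rewrite !gt_eqF.
Qed.

End one_curve.

(** So many steps of length r0 exhaust a curve of length 2 N c' t; t cancels, so the count is the
    same at all scales. *)
Definition chain_count : nat := (Num.truncn (2 * N * c' / scale_ratio)).+1.

(* The John curves leave the boundary at a definite rate, so near xi both have
   points whose averages are close to a and b; the uniformity curve between
   these points stays away from the boundary and its length is comparable to t. *)
Lemma scale_estimate (l m a b : R) (gamma eta : R -> 'rV[R]_n) :
  (forall x1 x2, Omega x1 -> Omega x2 -> exists kappa : R -> 'rV[R]_n,
    [/\ {within `[0, 1], continuous kappa}, kappa 0 = x1, kappa 1 = x2,
        forall s, 0 <= s <= 1 -> Omega (kappa s) &
        (curve_length kappa 0 1 <= (c' * enorm (x1 - x2))%:E)%E /\
        forall s, 0 <= s <= 1 ->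
          (Order.min (curve_length kappa 0 s) (curve_length kappa s 1)
           <= (c' * edist_set (kappa s) (boundary Omega))%:E)%E]) ->
  boundary_John_curve Omega c0 x0 xi l gamma ->
  boundary_John_curve Omega c0 x0 xi m eta ->
  t <= l -> t <= m ->
  (forall s : R, 0 < s <= t -> `|u (gamma s) - a| <= eps) ->
  (forall s : R, 0 < s <= t -> `|u (eta s) - b| <= eps) ->
  `|a - b| <= 2 * curve_bound + chain_count.+1%:R *
    (2 ^+ n * level_err1 t th delta + level_err2 t delta * \int[leb]_(x in U) J x).
Proof.
move=> unif Jg Je tl tm ga eb.
have q1 := John_const_le1 Jg tl.
have [s ss ps] := curve_side Jg tl ga.
have [s' ss' ps'] := curve_side Je tm eb.
set p1 := gamma s in ps; set p2 := eta s' in ps'.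
have free1 y : boundary Omega y -> ~ cube p1 d0 y := John_curve_free Jg tl ss.
have free2 y : boundary Omega y -> ~ cube p2 d0 y := John_curve_free Je tm ss'.
have self (p : 'rV[R]_n) (r : R) : 0 <= r -> cube p r p by move=> rr i; rewrite subrr normr0.
have O1 : Omega p1 by apply: (John_curve_cube Jg tl ss); exact/self/ltW.
have O2 : Omega p2 by apply: (John_curve_cube Je tm ss'); exact/self/ltW.
have near1 i : `|p1 ord0 i - xi ord0 i| <= t := John_curve_near Jg tl i ss.
have near2 i : `|p2 ord0 i - xi ord0 i| <= t := John_curve_near Je tm i ss'.
have [kappa [ck k0 k1 kO [klen kmin]]] := unif p1 p2 O1 O2.
have len_ge0 (a' b' : R) : a' <= b' -> (0 <= curve_length kappa a' b')%E.
  by move=> ab; apply: le_trans (enorm_le_curve_length kappa ab); rewrite lee_fin enorm_ge0.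
have p12 : enorm (p1 - p2) <= N * (2 * t).
  apply: enorm_le_coord => [|i]; first by rewrite mulr_ge0 // ltW.
  rewrite !mxE; have := ler_distD (xi ord0 i) (p1 ord0 i) (p2 ord0 i).
  by have := near1 i; have := near2 i; rewrite (distrC (xi ord0 i)); lra.
have klen2 : (curve_length kappa 0 1 <= (2 * N * c' * t)%:E)%E.
  apply: le_trans klen _; rewrite lee_fin.
  have -> : 2 * N * c' * t = c' * (N * (2 * t)) by ring.
  by rewrite ler_pM2l.
have knear (r : R) i : 0 <= r <= 1 -> `|kappa r ord0 i - p1 ord0 i| <= 2 * N * c' * t.
  move=> /andP[]; rewrite le_eqVlt => /predU1P[<- _|r_gt0 r1].
    by rewrite k0 subrr normr0 !mulr_ge0 // ltW.
  have H := le_trans (curve_length_split kappa r_gt0 r1) klen2.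
  have := coord_le_enorm (kappa r - kappa 0) i; rewrite !mxE -k0 => /le_trans; apply.
  by rewrite -lee_fin; apply: le_trans H; rewrite leeDl // len_ge0.
(* A boundary point y within 2 r0 <= d0 / 4 of kappa r would be farther than d0 from p1 and from p2.
   Both parts of kappa then have length at least d0 / 2, and so has c' times the boundary distance;
   yet that is at most c' N d0 w / 4 < d0 / 4. *)
have kfree (r : R) y : 0 <= r <= 1 -> boundary Omega y -> ~ cube (kappa r) (2 * r0) y.
  move=> r01 Oy cy; have /andP[r_ge0 r_le1] := r01.
  have split1 p : (forall y, boundary Omega y -> ~ cube p d0 y) -> d0 / 2 < `|kappa r - p|.
    have hd0 : 0 <= d0 / 2 by rewrite divr_ge0 // ltW.
    move=> fr; rewrite ltNge; apply/negP => /(rV_norm_le _ hd0) H.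
    apply: (fr y Oy) => i; have := H i; rewrite !mxE => hi.
    have := ler_distD (kappa r ord0 i) (y ord0 i) (p ord0 i); have := cy i.
    by have := r0d0; have := ltW d00; lra.
  have norm_enorm (v : 'rV[R]_n) : `|v| <= enorm v.
    by apply/(rV_norm_le _ (enorm_ge0 _)) => i; exact: coord_le_enorm.
  have l1 : ((d0 / 2)%:E <= curve_length kappa 0 r)%E.
    apply: le_trans (enorm_le_curve_length kappa r_ge0); rewrite lee_fin k0.
    by apply: le_trans (norm_enorm _); exact/ltW/split1.
  have l2 : ((d0 / 2)%:E <= curve_length kappa r 1)%E.
    apply: le_trans (enorm_le_curve_length kappa r_le1); rewrite lee_fin k1.
    by apply: le_trans (norm_enorm _); rewrite distrC; exact/ltW/split1.
  have : ((d0 / 2)%:E <= (c' * edist_set (kappa r) (boundary Omega))%:E)%E.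
    by apply: le_trans (kmin r r01); rewrite le_min l1.
  rewrite lee_fin.
  have := edist_set_le (kappa r) Oy.
  have en : enorm (kappa r - y) <= N * (2 * r0).
    apply: enorm_le_coord => [|i]; first by rewrite mulr_ge0 // ltW.
    by rewrite !mxE distrC; exact: cy.
  move=> /le_trans/(_ en); rewrite r0E => ed.
  have : c' * edist_set (kappa r) (boundary Omega) <= c' * (N * (d0 * w / 4)).
    by rewrite ler_pM2l.
  have -> : c' * (N * (d0 * w / 4)) = d0 / 4 * (c' / (1 + c')).
    by rewrite /w; field; rewrite !gt_eqF // addr_gt0.
  have : d0 / 4 * (c' / (1 + c')) <= d0 / 4.
    have c'1 : c' / (1 + c') <= 1 by rewrite ler_pdivrMr ?addr_gt0 // mul1r lerDr.
    by apply: ler_piMr => //; rewrite divr_ge0 // ltW.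
  by move: d00; lra.
have r0t : 2 * r0 <= t.
  have q2t : q ^+ 2 * t <= t by rewrite ler_piMl ?(ltW t0) // exprn_ile1 // ltW.
  by move: r0d0 q2t; rewrite /d0; have := ltW t0; lra.
have kU (r : R) : 0 <= r <= 1 -> cube (kappa r) (2 * r0) `<=` U.
  move=> r01; rewrite subsetI; split.
    apply: cube_sub_domain => //; first exact: kO.
      by rewrite mulr_ge0 // ltW.
    by move=> y; exact: kfree.
  apply: cube_subset => i; have := knear r i r01; have := near1 i.
  by have := ler_distD (p1 ord0 i) (kappa r ord0 i) (xi ord0 i); lra.
set D := 2 ^+ n * _ + _.
have IU0 : 0 <= \int[leb]_(x in U) J x by exact: Rintegral_ge0.
have D0 : 0 <= D.
  by rewrite addr_ge0 // mulr_ge0 ?exprn_ge0 ?level_err1_ge0 ?level_err2_ge0.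
have chain : `|avg Omega u p1 r0 - avg Omega u p2 r0| <= chain_count.+1%:R * D.
  rewrite -k0 -k1.
  apply: (@chain_estimate _ _ kappa (fun z => avg Omega u z r0) r0 D chain_count 0 1) => //.
    move=> r r' rr rr' close; apply: neighbor_diff => //; exact: kU.
  apply: le_trans klen2 _; rewrite lee_fin /r0 mulrA ler_pM2r //.
  rewrite -ler_pdivrMr //; apply: ltW.
  exact: Num.Theory.truncnS_gt.
move: ps ps' chain; move: (avg _ _ p1 _) (avg _ _ p2 _) (_ * D) curve_bound => A B X Y hA hB hX.
have := ler_distD A a b; have := ler_distD B A b.
by rewrite (distrC a A); move: hA hB hX; lra.
Qed.

End scale.

Lemma limits_agree (c0 c' : R) (xi x0 : 'rV[R]_n) (l m a b : R) (gamma eta : R -> 'rV[R]_n) :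
  (forall x, Omega x -> {for x, continuous u}) ->
  0 < c0 -> 0 < c' -> boundary Omega xi -> Omega x0 ->
  (forall x1 x2, Omega x1 -> Omega x2 -> exists kappa : R -> 'rV[R]_n,
    [/\ {within `[0, 1], continuous kappa}, kappa 0 = x1, kappa 1 = x2,
        forall s, 0 <= s <= 1 -> Omega (kappa s) &
        (curve_length kappa 0 1 <= (c' * enorm (x1 - x2))%:E)%E /\
        forall s, 0 <= s <= 1 ->
          (Order.min (curve_length kappa 0 s) (curve_length kappa s 1)
           <= (c' * edist_set (kappa s) (boundary Omega))%:E)%E]) ->
  (forall e : R, 0 < e -> exists2 t : R, 0 < t < e &
    ln t^-1 * \int[leb]_(x in scale_nbhd c' t xi) J x <= e) ->
  boundary_John_curve Omega c0 x0 xi l gamma ->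
  boundary_John_curve Omega c0 x0 xi m eta ->
  u (gamma t) @[t --> 0^'+] --> a -> u (eta t) @[t --> 0^'+] --> b -> a = b.
Proof.
move=> cu c00 c'0 bxi Ox0 unif good Jg Je ga eb.
apply/eqP; rewrite -subr_eq0 -normr_le0 leNgt; apply/negP => ab.
pose e : R := `|a - b|; rewrite -/e in ab.
(* A curve of length 0 would place the boundary point xi at x0, inside Omega. *)
have length_gt0 (l' : R) gamma' : boundary_John_curve Omega c0 x0 xi l' gamma' -> 0 < l'.
  move=> [[l0 _] g0 gl _ _]; rewrite lt_neqAle l0 andbT; apply/eqP => l0E.
  by apply: (boundary_open oO bxi); rewrite -g0 l0E gl.
have l0 := length_gt0 _ _ Jg; have m0 := length_gt0 _ _ Je.
have e16 : 0 < e / 16 by rewrite divr_gt0.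
have near_lim (v : R -> R) (c : R) : v t @[t --> 0^'+] --> c ->
    exists2 d : R, 0 < d & forall s : R, 0 < s < d -> `|v s - c| <= e / 16.
  move=> /cvgrPdist_le/(_ _ e16)[d /= d0 H]; exists d => // s /andP[s0 sd].
  by rewrite distrC; apply: H => //=; rewrite sub0r normrN gtr0_norm.
have [d1 d10 H1] := near_lim _ _ ga; have [d2 d20 H2] := near_lim _ _ eb.
pose th := scale_ratio c0 c'.
have N0 : 0 < n%:R :> R by rewrite ltr0n (leq_trans _ n2).
have th0 : 0 < th.
  rewrite /th /scale_ratio divr_gt0 // mulr_gt0 // ?exprn_gt0 // invr_gt0 mulr_gt0 //.
  by rewrite addr_gt0.
(* For t <= 1 this bounds [level_err1] / delta independently of t. *)
pose K1 := level_const * (2 * 2 ^+ n + IG / th ^+ n).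
have K10 : 0 <= K1.
  rewrite mulr_ge0 ?level_const_ge0 // addr_ge0 ?mulr_ge0 ?exprn_ge0 //.
  by rewrite invr_ge0 exprn_ge0 // ltW.
pose c4 : R := (chain_count c0 c').+1%:R.
pose c3 : R := (2 + 2 * n%:R) * (4 * scale_ratio c0 c' / (c0 * n%:R)^-1 + 1).
have c40 : 0 <= c4 by [].
have c30 : 0 <= c3.
  have q0 : 0 <= (c0 * n%:R)^-1 by rewrite invr_ge0 mulr_ge0 // ltW.
  have f0 : 0 <= 4 * th / (c0 * n%:R)^-1 by rewrite divr_ge0 // mulr_ge0 // ltW.
  by rewrite /c3 mulr_ge0 // addr_ge0 // mulr_ge0.
pose A1 := (4 + c4 * 2 ^+ n) * K1.
have A10 : 0 <= A1 by rewrite mulr_ge0 // addr_ge0 // mulr_ge0 // exprn_ge0.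
(* delta is fixed before t because [A2] contains delta^(1-n). The eps-terms, the delta-terms and the
   terms with ln (1/t) times the local integral then contribute at most e / 4 each, and 3 e / 4 < e
   = |a - b|. *)
pose delta := e / 4 / (A1 + 1).
have A11 : 0 < A1 + 1 by rewrite ltr_wpDl.
have delta0 : 0 < delta by rewrite divr_gt0 // divr_gt0.
pose A2 := (2 * c3 + c4) * (level_const * (2 / lam * n.+1%:R) / delta ^+ n.-1).
have A20 : 0 <= A2.
  have f0 : 0 <= 2 / lam * n.+1%:R by rewrite mulr_ge0 // divr_ge0 // ltW.
  have f1 : 0 <= level_const * (2 / lam * n.+1%:R) / delta ^+ n.-1.
    by rewrite divr_ge0 ?exprn_ge0 ?(ltW delta0) // mulr_ge0 // level_const_ge0.
  by rewrite mulr_ge0 // addr_ge0 // mulr_ge0.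
have A21 : 0 < A2 + 1 by rewrite ltr_wpDl.
pose e' := Num.min (e / 4 / (A2 + 1)) (Num.min (expR (-1)) (Num.min (Num.min l m) (Num.min d1 d2))).
have e'0 : 0 < e' by rewrite !lt_min expR_gt0 l0 m0 d10 d20 divr_gt0 // divr_gt0.
have [t /andP[t0 te] It] := good _ e'0.
move: (te); rewrite !lt_min => /and4P[_ te1 /andP[tl tm] /andP[td1 td2]].
have lt1 : 1 <= ln t^-1.
  rewrite lnV ?posrE // lerNr -(expRK (-1)) ler_ln ?posrE ?expR_gt0 //; exact: ltW.
have t1 : t <= 1.
  apply: ltW; apply: lt_le_trans te1 _; rewrite -[leRHS]expR0 ler_expR; lra.
have Hg (s : R) : 0 < s <= t -> `|u (gamma s) - a| <= e / 16.
  by move=> /andP[s0 st]; apply: H1; rewrite s0 (le_lt_trans st).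
have He (s : R) : 0 < s <= t -> `|u (eta s) - b| <= e / 16.
  by move=> /andP[s0 st]; apply: H2; rewrite s0 (le_lt_trans st).
have := scale_estimate cu c00 c'0 t0 lt1 delta0 e16 bxi unif Jg Je (ltW tl) (ltW tm) Hg He.
rewrite -/e /curve_bound /= -/th -/c4.
set E1 := level_err1 _ _ _; set I := \int[leb]_(x in _) J x.
have I0 : 0 <= I by exact: Rintegral_ge0.
have E1le : E1 <= delta * K1.
  rewrite /E1 /level_err1 /K1 [leRHS]mulrCA -mulrA ler_wpM2l ?level_const_ge0 //.
  rewrite ler_wpM2l ?(ltW delta0) // lerD2l ler_wpM2r ?invr_ge0 ?exprn_ge0 ?(ltW th0) //.
  by rewrite ler_piMl.
pose E2 := level_const * (2 / lam * n.+1%:R) / delta ^+ n.-1.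
have E20 : 0 <= E2.
  rewrite /E2 divr_ge0 ?exprn_ge0 ?(ltW delta0) // mulr_ge0 ?level_const_ge0 //.
  by rewrite mulr_ge0 // divr_ge0 // ltW.
have E2E : level_err2 t delta * I = E2 * (ln t^-1 * I).
  by rewrite /level_err2 /E2; move: level_const (delta ^+ _) => x y; ring.
have IJe : ln t^-1 * I <= e / 4 / (A2 + 1).
  by apply: le_trans It _; rewrite ge_min lexx.
have b1 : (4 + c4 * 2 ^+ n) * E1 <= e / 4.
  apply: le_trans (_ : A1 * delta <= _).
    rewrite /A1 -mulrA (mulrC K1) ler_wpM2l // addr_ge0 // mulr_ge0 // exprn_ge0 //.
  rewrite /delta mulrCA ler_piMr ?divr_ge0 ?(ltW ab) // ler_pdivrMr // mul1r lerDl //.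
have b2 : (2 * c3 + c4) * (level_err2 t delta * I) <= e / 4.
  rewrite E2E mulrA -/A2.
  apply: le_trans (ler_wpM2l A20 IJe) _.
  rewrite mulrCA ler_piMr ?divr_ge0 ?(ltW ab) // ler_pdivrMr // mul1r lerDl //.
have -> : 2 * (2 * (e / 16) + 2 * E1 +
      level_err2 t delta * (2 + 2 * n%:R) * (4 * th / (c0 * n%:R)^-1 + 1) * I) +
    c4 * (2 ^+ n * E1 + level_err2 t delta * I) =
   e / 4 + (4 + c4 * 2 ^+ n) * E1 + (2 * c3 + c4) * (level_err2 t delta * I).
  rewrite /c3 -/th; move: (level_err2 _ _) (_ / (c0 * _)^-1) => x y; by field.
by move: b1 b2 ab; lra.
Qed.

End energy.

(** * Sets of Hausdorff measure zero and the divergence of the gauge integral *)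

Section hausdorff_null.
Context {R : realType} {n : nat}.
Implicit Types (A B : set 'rV[R]_n) (h : R -> R).

Lemma fine_ediam_itv (d : R) A : 0 <= d -> (ediam A <= d%:E)%E ->
  0 <= fine (ediam A) <= d.
Proof.
move=> d0 Ad; have [->|/set0P[x Ax]] := eqVneq A set0.
  by rewrite /ediam set0X image_set0 ereal_sup0 /= lexx.
have A0 : (0 <= ediam A)%E.
  apply: ereal_sup_ubound; exists (x, x) => //=.
  by rewrite subrr /enorm big1 ?sqrtr0// => i _; rewrite mxE expr0n.
have Af : ediam A \is a fin_num by rewrite ge0_fin_numE// (le_lt_trans Ad)// ltry.
by rewrite -!lee_fin fineK// A0.
Qed.

Lemma ediam_sub_cube A p (r : R) : 0 <= r -> A `<=` cube p r ->
  (ediam A <= (n%:R * (2 * r))%:E)%E.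
Proof.
move=> r0 Ap; apply: ge_ereal_sup => _ [[x y] /= [Ax Ay] <-]; rewrite lee_fin.
apply: enorm_le_coord => [|i]; first by rewrite mulr_ge0.
have := Ap _ Ax i; have := Ap _ Ay i; rewrite !mxE !ler_norml /=.
by move=> /andP[? ?] /andP[? ?]; apply/andP; split; lra.
Qed.

(** An explicit cover in place of a bound on the infimum [hausdorff_content], so that covers can be
    combined. *)
Definition covered_at h (d e : R) A := exists E : (set 'rV[R]_n)^nat,
  [/\ A `<=` \bigcup_k E k, forall k, (ediam (E k) <= d%:E)%E &
      (\sum_(0 <= k <oo) (h (fine (ediam (E k))))%:E <= e%:E)%E].

Lemma covered_at_sub h (d e : R) A B : A `<=` B ->
  covered_at h d e B -> covered_at h d e A.
Proof. by move=> AB [E [BE Ed Ee]]; exists E; split=> // x /AB/BE. Qed.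

Lemma covered_at_bigcup h (d : R) (B : (set 'rV[R]_n)^nat) :
  0 <= d -> (forall t : R, 0 <= t <= d -> 0 <= h t) ->
  (forall m (e : R), 0 < e -> covered_at h d e (B m)) ->
  forall e : R, 0 < e -> covered_at h d e (\bigcup_m B m).
Proof.
move=> d0 h0 cB e e0.
have /choice[E HE] : forall m : nat, exists E : (set 'rV[R]_n)^nat,
    [/\ B m `<=` \bigcup_k E k, forall k, (ediam (E k) <= d%:E)%E &
      (\sum_(0 <= k <oo) (h (fine (ediam (E k))))%:E <= (e / (2 ^ m.+1)%:R)%:E)%E].
  by move=> m; apply: cB; rewrite divr_gt0// ltr0n expn_gt0.
have h0' m k : (0 <= (h (fine (ediam (E m k))))%:E)%E.
  by rewrite lee_fin h0//; apply: fine_ediam_itv => //; case: (HE m).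
have /card_esym/ppcard_eqP[f] := card_nat2.
exists (fun k => E (f k).1 (f k).2); split => [x [m _ Bx]|k|].
- case: (HE m) => /(_ _ Bx)[k _ Ex] _ _.
  by exists (f^-1%FUN (m, k)) => //=; rewrite invK ?inE.
- by case: (HE (f k).1).
rewrite nneseries_esumT; last by move=> k; exact: h0'.
rewrite -(@reindex_esum _ _ _ [set: nat] [set: nat * nat] f
  (fun p => (h (fine (ediam (E p.1 p.2))))%:E)); last first.
  by split.
rewrite [X in esum X _](_ : _ = [set: nat] `*`` (fun=> [set: nat])); last first.
  by apply/seteqP; split.
rewrite -(@esum_esum _ _ _ _ _ (fun m k => (h (fine (ediam (E m k))))%:E))//.
apply: (@le_trans _ _ (\esum_(m in [set: nat]) (e / (2 ^ m.+1)%:R)%:E)%E).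
  apply: le_esum => m _; rewrite -nneseries_esumT//.
  by case: (HE m).
rewrite -nneseries_esumT; last by move=> m; rewrite lee_fin divr_ge0// ltW.
exact: (epsilon_trick0 xpredT (ltW e0)).
Qed.

(** The finite family is continued by empty sets at no cost: their [ediam] is -oo, which [fine]
    sends to 0, and h 0 = 0. *)
Lemma covered_at_finite h (d v : R) (I : finType) (P : pred I)
    (E : I -> set 'rV[R]_n) A :
  h 0 = 0 -> 0 <= d -> 0 <= v -> (forall t : R, 0 <= t <= d -> 0 <= h t) ->
  A `<=` \bigcup_(i in [set i | P i]) E i ->
  (forall i, P i -> (ediam (E i) <= d%:E)%E /\ h (fine (ediam (E i))) <= v) ->
  covered_at h d (#|P|%:R * v) A.
Proof.
move=> h00 d0 v0 h0 AE HE.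
pose s := [seq E i | i <- enum P].
have d00 : ediam (set0 : set 'rV[R]_n) = -oo%E.
  by rewrite /ediam set0X image_set0 ereal_sup0.
have sP k : (k < size s)%N ->
    (ediam (nth set0 s k) <= d%:E)%E /\ h (fine (ediam (nth set0 s k))) <= v.
  move=> ks; have : nth set0 s k \in [seq E i | i <- enum P] by exact: mem_nth.
  by move=> /mapP[i]; rewrite mem_enum => /HE + ->.
have sd k : (ediam (nth set0 s k) <= d%:E)%E.
  have [ks|ks] := ltnP k (size s); first by case: (sP _ ks).
  by rewrite nth_default// d00 leNye.
have h0' k : (0 <= (h (fine (ediam (nth set0 s k))))%:E)%E.
  by rewrite lee_fin h0//; exact: fine_ediam_itv.
exists (nth set0 s); split => // [x /AE[i /= Pi Ex]|].
  have si : E i \in s by rewrite map_f// mem_enum.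
  by exists (index (E i) s) => //=; rewrite nth_index.
apply: lime_le; first by apply: is_cvg_nneseries => k _ _; exact: h0'.
apply: nearW => N.
suff H : (\sum_(0 <= k < N) (h (fine (ediam (nth set0 s k))))%:E <=
    ((minn N (size s))%:R * v)%:E)%E.
  apply: (le_trans H); rewrite lee_fin ler_wpM2r// ler_nat.
  by rewrite (leq_trans (geq_minr _ _))// size_map -cardE.
elim: N => [|N IH]; first by rewrite big_geq// min0n mul0r.
rewrite big_nat_recr//=; have [Ns|Ns] := ltnP N (size s).
  rewrite (minn_idPl Ns) -natr1 mulrDl mul1r EFinD; move: IH.
  rewrite (minn_idPl (ltnW Ns)) => IH; apply: leeD => //.
  by rewrite lee_fin; case: (sP _ Ns).
rewrite nth_default// d00 /= h00 adde0 (le_trans IH)// lee_fin ler_wpM2r// ler_nat.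
by rewrite leq_min geq_minr (leq_trans (geq_minl _ _)).
Qed.

(** The sign of h is known only on [0, d0], so the contents are computed for d <= d0; the limit at 0
    sees no others. *)
Lemma hausdorff_measure_eq0 h (d0 : R) A :
  0 < d0 -> (forall t : R, 0 <= t <= d0 -> 0 <= h t) ->
  (forall d e : R, 0 < d <= d0 -> 0 < e -> covered_at h d e A) ->
  hausdorff_measure h A = 0%E.
Proof.
move=> d00 h0 cA.
have H (d : R) : 0 < d <= d0 -> hausdorff_content h d A = 0%E.
  move=> /andP[dp dd0]; apply/eqP; rewrite eq_le; apply/andP; split.
    apply/lee_addgt0Pr => e e0; rewrite add0e.
    have [|E [AE Ed Ee]] := cA d e _ e0; first by rewrite dp.
    by apply: le_trans Ee; apply: ereal_inf_lbound; exists E.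
  apply: le_ereal_inf_tmp => _ [E [_ Ed] <-].
  apply: nneseries_ge0 => k _ _; rewrite lee_fin h0//.
  have /andP[-> fd] := fine_ediam_itv (ltW dp) (Ed k).
  exact: le_trans fd dd0.
apply: cvg_lim => //.
apply: cvg_near_cst; near=> d; apply: H.
by apply/andP; split; near: d; [exact: nbhs_right_gt|exact: nbhs_right_le].
Unshelve. all: by end_near. Qed.

End hausdorff_null.

(* A gauge is controlled only near 0, so the integrand of gauge_integrable need
   not be measurable; the integral is a supremum over simple functions. *)
Lemma ge0_le_integral_nonmeasurable d (T : measurableType d) (R : realType)
    (mu : {measure set T -> \bar R}) (D1 D2 : set T) (f1 f2 : T -> \bar R) :
  D1 `<=` D2 -> (forall x, D1 x -> (0 <= f1 x)%E) ->
  (forall x, D2 x -> (0 <= f2 x)%E) -> (forall x, D1 x -> (f1 x <= f2 x)%E) ->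
  (\int[mu]_(x in D1) f1 x <= \int[mu]_(x in D2) f2 x)%E.
Proof.
move=> D12 f10 f20 f12; rewrite !ge0_integralE//.
apply: ereal_sup_le => _ [k /= kf <-]; exists k => // x.
apply: (le_trans (kf x)); rewrite !patchE.
case: ifPn => [|_]; last by case: ifPn => // /set_mem/f20.
by move=> /set_mem xD; rewrite mem_set; [exact: f12|exact: D12].
Qed.

Lemma integral_inv (R : realType) (k a b : R) : 0 < a -> a < b ->
  (\int[lebesgue_measure]_(t in `[a, b]) (k / t)%:E = (k * (ln b - ln a))%:E)%E.
Proof.
move=> a0 ab.
have D (x : R) : 0 < x -> is_derive x 1 (fun t => k * ln t) (k / x).
  move=> x0; have := is_derive1_ln x0 => H.
  exact: (is_deriveZ k H).
apply: (etrans (@continuous_FTC2 _ (fun t : R => k / t) (fun t => k * ln t) _ _ ab _ _ _)); last 2 first.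
- move=> x; rewrite in_itv /= => /andP[ax _].
  by rewrite derive1E; have [_ ->] := D x (lt_trans a0 ax).
- by rewrite -EFinB mulrBr.
- apply: continuous_in_subspaceT => x; rewrite inE /= in_itv /= => /andP[ax _].
  have x0 : 0 < x by exact: lt_le_trans ax.
  by apply: cvgM; [exact: cvg_cst|apply: cvgV; [rewrite gt_eqF|exact: cvg_id]].
- have cl (x : R) : 0 < x -> {for x, continuous (fun t => k * ln t)}.
    by move=> x0; apply: cvgM; [exact: cvg_cst|exact: continuous_ln].
  split.
  + move=> x; rewrite in_itv /= => /andP[ax _].
    by have [] := D x (lt_trans a0 ax).
  + by apply: cvg_at_right_filter; exact: cl.
  + by apply: cvg_at_left_filter; apply: cl; exact: lt_trans ab.
Qed.

(** Otherwise h(t) ln (1/t) >= c near 0, and the integrand dominates k / t with k = c^(1/(n-1)),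
    whose integral diverges. *)
Lemma gauge_integrable_liminf (R : realType) (n : nat) (h : R -> R) :
  (2 <= n)%N -> gauge_integrable n h ->
  forall c tau : R, 0 < c -> 0 < tau ->
  exists2 t : R, 0 < t < tau & h t * ln t^-1 < c.
Proof.
move=> n2 [eps /andP[eps0 eps1] hoo] c tau c0 tau0.
apply/not_exists2P => H.
pose k : R := c `^ (1 / (n%:R - 1)).
have k0 : 0 < k by rewrite powR_gt0.
pose b := Num.min tau eps / 2.
have m0 : 0 < Num.min tau eps by rewrite lt_min tau0.
have b0 : 0 < b by rewrite divr_gt0.
have bm : b < Num.min tau eps by rewrite /b ltr_pdivrMr// ltr_pMr// ltr1n.
have [bt be] : b < tau /\ b < eps by move: bm; rewrite lt_min => /andP.
move: hoo; set I := (X in (X < _)%E) => hoo.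
have Ia (a : R) : 0 < a -> a < b -> ((k * (ln b - ln a))%:E <= I)%E.
  move=> a0 ab; rewrite -integral_inv//.
  apply: ge0_le_integral_nonmeasurable => [t|t|t|t] /=; rewrite !in_itv /= => /andP[at_ tb].
  - by apply/andP; split; [exact: lt_le_trans at_|exact: le_lt_trans be].
  - by rewrite lee_fin divr_ge0 ?(ltW k0)// (le_trans (ltW a0)).
  - by rewrite lee_fin divr_ge0 ?powR_ge0// ltW.
  - have t0 : 0 < t by exact: lt_le_trans at_.
    rewrite lee_fin ler_pM2r ?invr_gt0//; apply: ge0_ler_powR.
    + by rewrite divr_ge0// subr_ge0 ler1n ltnW.
    + by rewrite nnegrE ltW.
    + have [|] := H t; first by rewrite t0 (le_lt_trans tb bt).
      by rewrite div1r => /negP; rewrite -leNgt nnegrE; apply: le_trans; exact: ltW.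
    + have [|] := H t; first by rewrite t0 (le_lt_trans tb bt).
      by rewrite div1r => /negP; rewrite -leNgt.
have I0 : (0 <= I)%E.
  apply: integral_ge0 => t; rewrite /= in_itv /= => /andP[t0 _].
  by rewrite lee_fin divr_ge0 ?powR_ge0// ltW.
have If : I \is a fin_num by rewrite ge0_fin_numE.
(* The integral of k / t over [b exp (-M), b] is k M = I + k, which exceeds I. *)
pose M := fine I / k + 1.
have M0 : 0 < M by rewrite ltr_wpDl// divr_ge0 ?fine_ge0// ltW.
have M1 : b * expR (- M) < b by rewrite gtr_pMr// expR_lt1 oppr_lt0.
have := Ia _ (mulr_gt0 b0 (expR_gt0 (- M))) M1.
rewrite (lnM b0 (expR_gt0 _)) expRK opprD opprK addrA subrr add0r -(fineK If) lee_fin.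
by rewrite /M mulrDr mulr1 mulrC divfK ?gt_eqF// leNgt ltrDl k0.
Qed.

(** * Points where ln (1/t) times the local energy stays bounded below *)

Section slow_energy.
Context {R : realType} {n : nat}.
Implicit Types (Omega A : set 'rV[R]_n) (J : 'rV[R]_n -> R).
Local Notation leb := (lebesgue_rV R n).

(** Nearness in the sup norm decouples the coordinates, so the count is a product of counts in
    progressions. *)
Lemma card_grid_near (P : nat) (x : 'rV[R]_n) (al s rho : R) :
  0 < s -> 0 <= rho ->
  (#|[pred z : {ffun 'I_n -> 'I_P} |
      `[< cube (\row_i (al + (z i)%:R * s)) rho x >] ]|%:R : R) <=
  (2 * rho / s + 1) ^+ n.
Proof.
move=> s0 rho0.
pose F (i : 'I_n) : pred 'I_P := [pred a : 'I_P | `|x ord0 i - (al + a%:R * s)| <= rho].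
apply: (@le_trans _ _ (#|family F|%:R)).
  rewrite ler_nat subset_leq_card//; apply/fintype.subsetP => z.
  rewrite inE => /asboolP/asboolP Hz; apply/familyP => i; rewrite inE.
  by have := Hz i; rewrite mxE.
have -> : #|family F| = _ := card_family F.
rewrite foldrE big_map big_enum /= natr_prod.
apply: (@le_trans _ _ (\prod_(i < n) (2 * rho / s + 1))).
  by apply: ler_prod => i _; rewrite ler0n card_near_progression.
by rewrite prodr_const card_ord.
Qed.

Lemma covered_at_le (h : R -> R) (d e e' : R) A : e <= e' ->
  covered_at h d e A -> covered_at h d e' A.
Proof.
by move=> ee [E [AE Ed Ee]]; exists E; split=> //; rewrite (le_trans Ee)// lee_fin.
Qed.

(* Cover A by grid cubes of side t / n with h t ln (1/t) < c: each carries energy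
   at least mu / ln (1/t) in a bounded enlargement and the enlargements have
   bounded overlap, so there are at most about ln (1/t) / mu cubes. *)
Lemma covered_at_energy Omega A J (h : R -> R) (dh Rb C1 mu d e : R) :
  (0 < n)%N -> measurable Omega -> (forall x, 0 <= J x) ->
  leb.-integrable Omega (EFin \o J) ->
  h 0 = 0 -> (forall t : R, 0 <= t <= dh -> 0 <= h t) ->
  {in `[0, dh] &, {homo h : s t / s <= t}} ->
  (forall c tau : R, 0 < c -> 0 < tau ->
    exists2 t : R, 0 < t < tau & h t * ln t^-1 < c) ->
  0 <= C1 -> 0 < mu -> 0 < Rb -> A `<=` cube 0 Rb ->
  (forall xi, A xi -> forall t : R, 0 < t < mu ->
     mu < ln t^-1 * \int[leb]_(x in Omega `&` cube xi (C1 * t)) J x) ->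
  0 < d <= dh -> 0 < e -> covered_at h d e A.
Proof.
move=> n0 mO J0 iJ h00 h0 hm lim C10 mu0 Rb0 AR HA /andP[d0 ddh] e0.
have N0 : 0 < n%:R :> R by rewrite ltr0n.
have mJ := measurable_int _ iJ.
pose I := (\int[leb]_(x in Omega) (J x)%:E)%E.
have If : I \is a fin_num by apply: integrable_fin_num.
have I0 : (0 <= I)%E by apply: integral_ge0 => x _; rewrite lee_fin.
(* The value of 2 rho / s + 1 for rho = C1 t + s and s = t / (2n); it is independent of t. *)
pose M : R := 2 * (C1 * (2 * n%:R) + 1) + 1.
have M0 : 0 < M by rewrite ltr_wpDl// mulr_ge0// addr_ge0// !mulr_ge0.
(* From #|S| <= M^n I L / mu and h t < c / L, this c gives #|S| h(t) <= e. The added 1 keeps the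
   denominator positive if I = 0. *)
pose c := e * mu / (M ^+ n * (fine I + 1)).
have I1 : 0 < fine I + 1 by rewrite ltr_wpDl// fine_ge0.
have c0 : 0 < c by rewrite divr_gt0 ?mulr_gt0 ?exprn_gt0.
pose tau := Num.min (Num.min d mu) 1.
have tau0 : 0 < tau by rewrite !lt_min d0 mu0 ltr01.
have [t /andP[t0]] := lim c tau c0 tau0.
rewrite !lt_min => /andP[/andP[td tmu] t1] htc.
pose L : R := ln t^-1.
have L0 : 0 < L by rewrite ln_gt0// invf_gt1.
(* A cell of radius s has Euclidean diameter at most n (2 s) = t, so the gauge of its diameter is at
   most h t. *)
pose s := t / (2 * n%:R).
have s0 : 0 < s by rewrite divr_gt0// mulr_gt0.
pose P := (Num.truncn (2 * Rb / s)).+1.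
pose cen (z : {ffun 'I_n -> 'I_P}) : 'rV[R]_n := \row_i (- Rb + (z i)%:R * s).
pose cell z := A `&` cube (cen z) s.
pose S := [pred z | `[< cell z !=set0 >]].
pose Q z := Omega `&` cube (cen z) (C1 * t + s).
have rho0 : 0 <= C1 * t + s by rewrite addr_ge0 ?mulr_ge0// ltW.
have mQ z : measurable (Q z) by apply: measurableI => //; exact: measurable_cube.
have ns : n%:R * (2 * s) = t by rewrite /s; field; rewrite gt_eqF.
have cov : A `<=` \bigcup_(z in [set z | S z]) cell z.
  move=> x Ax.
  have xi i : 0 <= (x ord0 i + Rb) / s <= 2 * Rb / s.
    have := AR _ Ax i; rewrite mxE subr0 ler_norml => /andP[? ?].
    by rewrite divr_ge0 ?ler_pM2r ?invr_gt0 ?(ltW s0)//; lra.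
  have ai i : (Num.truncn ((x ord0 i + Rb) / s) < P)%N.
    by rewrite ltnS; apply: le_truncn; have /andP[] := xi i.
  pose z : {ffun 'I_n -> 'I_P} := [ffun i => Ordinal (ai i)].
  have cz : cell z x.
    split=> // i; rewrite mxE ffunE /=.
    have /andP[x1 x2] := xi i.
    have /andP[] := truncn_itv x1; move: (Num.truncn _) => k.
    rewrite ler_pdivlMr// ltr_pdivrMr// -[k.+1]addn1 natrD mulrDl mul1r => ? ?.
    by rewrite ler_norml; apply/andP; split; lra.
  by exists z => //=; apply/asboolP; exists x.
have HE z : S z -> (ediam (cell z) <= d%:E)%E /\ h (fine (ediam (cell z))) <= h t.
  move=> _.
  have cd : (ediam (cell z) <= t%:E)%E.
    have cc : cell z `<=` cube (cen z) s by move=> x [].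
    by have := ediam_sub_cube (ltW s0) cc; rewrite ns.
  have /andP[f0 ft] := fine_ediam_itv (ltW t0) cd.
  split; first by rewrite (le_trans cd)// lee_fin ltW.
  have tdh : t <= dh by rewrite (le_trans (ltW td)).
  by apply: hm => //; rewrite in_itv /= ?f0 ?(le_trans ft)// (ltW t0).
have ht0 : 0 <= h t by rewrite h0// (ltW t0) (le_trans (ltW td)).
have h0d (r : R) : 0 <= r <= d -> 0 <= h r.
  by move=> /andP[r0 rd]; rewrite h0// r0 (le_trans rd).
apply: covered_at_le (covered_at_finite h00 (ltW d0) ht0 h0d cov HE).
have QS z : S z -> ((mu / L)%:E <= \int[leb]_(x in Q z) (J x)%:E)%E.
  move=> /asboolP[xi [Axi xiz]].
  have := HA _ Axi t; rewrite t0 tmu => /(_ isT); rewrite mulrC -ltr_pdivrMr// => H.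
  pose Z := Omega `&` cube xi (C1 * t).
  have mZ : measurable Z by apply: measurableI => //; exact: measurable_cube.
  have iZ : leb.-integrable Z (EFin \o J).
    by apply: integrableS iJ => //; exact: subIsetl.
  apply: (@le_trans _ _ (\int[leb]_(x in Z) (J x)%:E)%E).
    by rewrite -(fineK (integrable_fin_num mZ iZ)) lee_fin ltW.
  apply: ge0_subset_integral => //.
  - by apply: measurable_funS mJ => //; exact: subIsetl.
  - by move=> x _; rewrite lee_fin.
  - apply: setIS; apply: cube_subset => i.
    by have := xiz i; rewrite /=; lra.
have sumQ : (\sum_z \int[leb]_(x in Q z) (J x)%:E <= (M ^+ n)%:E * I)%E.
  apply: sum_integral_overlap => //.
  - by move=> z; exact: subIsetl.
  - exact/measurable_EFinP.
  - by rewrite exprn_ge0// ltW.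
  - move=> x _.
    have -> : M = 2 * (C1 * t + s) / s + 1.
      by rewrite /M /s; field; rewrite !gt_eqF.
    apply: le_trans (card_grid_near P x (- Rb) s0 rho0).
    rewrite ler_nat subset_leq_card//; apply/fintype.subsetP => z.
    by rewrite !unfold_in /= => /asboolP[_ Qz]; exact/asboolP.
have sumS : ((#|S|%:R * (mu / L))%:E <= \sum_z \int[leb]_(x in Q z) (J x)%:E)%E.
  apply: (@le_trans _ _ (\sum_(z in S) \int[leb]_(x in Q z) (J x)%:E)%E).
    rewrite mulr_natl -sumr_const -sumEFin; apply: lee_sum => z; exact: QS.
  rewrite [leRHS](bigID (mem S)) /= leeDl// sume_ge0// => z _.
  by apply: integral_ge0 => x _; rewrite lee_fin.
have : #|S|%:R * (mu / L) <= M ^+ n * fine I.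
  by rewrite -lee_fin [leRHS]EFinM fineK// (le_trans sumS).
have Mn0 : 0 < M ^+ n by rewrite exprn_gt0.
move: htc; rewrite -/L -ltr_pdivlMr// => /ltW htc H.
apply: (@le_trans _ _ (#|S|%:R * (c / L))); first by rewrite ler_wpM2l.
have -> : #|S|%:R * (c / L) = c / mu * (#|S|%:R * (mu / L)).
  by field; rewrite !gt_eqF.
apply: (@le_trans _ _ (c / mu * (M ^+ n * (fine I + 1)))).
  apply: ler_wpM2l; first by apply: divr_ge0; exact: ltW.
  by apply: (le_trans H); apply: ler_wpM2l; [exact: ltW|rewrite lerDl].
rewrite le_eqVlt /c; apply/orP; left; apply/eqP.
by field; rewrite !gt_eqF.
Qed.
End slow_energy.

(** The lower bound depends on xi while the count needs a uniform one. The sets [B m], on which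
    1/(m+1) serves as such a bound, exhaust A. *)
Lemma slow_energy_null (R : realType) (n : nat) (Omega A : set 'rV[R]_n)
    (J : 'rV[R]_n -> R) (h : R -> R) (Rb C1 : R) :
  (2 <= n)%N -> measurable Omega -> (forall x, 0 <= J x) ->
  (lebesgue_rV R n).-integrable Omega (EFin \o J) ->
  gauge h -> gauge_integrable n h -> 0 <= C1 -> 0 < Rb -> A `<=` cube 0 Rb ->
  (forall xi, A xi -> exists2 e : R, 0 < e & forall t : R, 0 < t < e ->
     e < ln t^-1 *
       \int[lebesgue_rV R n]_(x in Omega `&` cube xi (C1 * t)) J x) ->
  hausdorff_measure h A = 0%E.
Proof.
move=> n2 mO J0 iJ [h00 [dh dh0 [_ hm hp]]] hI C10 Rb0 AR HA.
have h0 (t : R) : 0 <= t <= dh -> 0 <= h t.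
  move=> /andP[]; rewrite le_eqVlt => /orP[/eqP <- _|t0 td]; first by rewrite h00.
  by apply/ltW/hp; rewrite t0.
apply: (hausdorff_measure_eq0 dh0 h0) => d e0 dd e00.
pose B (m : nat) := [set xi | A xi /\ forall t : R, 0 < t < m.+1%:R^-1 ->
  m.+1%:R^-1 < ln t^-1 *
    \int[lebesgue_rV R n]_(x in Omega `&` cube xi (C1 * t)) J x].
apply: (@covered_at_sub _ _ _ _ _ _ (\bigcup_m B m)) => [xi Ax|].
  have [e ep He] := HA _ Ax.
  exists (Num.truncn e^-1) => //; split=> // t /andP[t0 tm].
  have em : (Num.truncn e^-1).+1%:R^-1 < e.
    rewrite -[ltRHS]invrK ltf_pV2 ?posrE ?invr_gt0//.
    by rewrite -truncn_le_nat.
  apply: (lt_trans em); apply: He; rewrite t0/=.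
  exact: lt_trans em.
have [d0 ddh] := andP dd.
apply: covered_at_bigcup => // [|t /andP[t0 td]|m e ep]; first exact: ltW.
  by rewrite h0// t0 (le_trans td).
apply: (covered_at_energy _ mO J0 iJ h00 h0 hm _ C10 _ Rb0 _ _ dd ep (mu := m.+1%:R^-1)) => //.
- exact: ltnW.
- by move=> c tau c0 tau0; exact: (gauge_integrable_liminf n2 hI).
- by move=> x [/AR].
- by move=> x [].
Qed.

(** * From the class F to the hypotheses of the energy estimates *)

Section class_F_estimates.
Context {R : realType} {n : nat}.
Implicit Types (Omega : set 'rV[R]_n) (u : 'rV[R]_n -> R) (M : 'M[R]_n).
Local Notation leb := (lebesgue_rV R n).

Lemma L1loc_measurable Omega u : open Omega -> L1loc Omega u ->
  measurable_fun Omega u.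
Proof.
move=> oO Lu; have [F OF FF] := open_bigcup_compact oO.
rewrite OF; apply/measurable_fun_bigcup => k; first by case: (FF k).
have [_ cF] := FF k; apply/measurable_EFinP.
have FO : F k `<=` Omega by rewrite OF => x Fx; exists k.
exact: measurable_int (Lu _ cF FO).
Qed.

(** Needed before [opnorm] can bound anything: the real [sup] of an unbounded set is a default
    value. *)
Lemma opnorm_has_sup M :
  has_sup [set enorm (v *m M) | v in [set v : 'rV[R]_n | enorm v <= 1]].
Proof.
split.
  exists (enorm (0 *m M)), 0 => //=.
  by rewrite /enorm big1 ?sqrtr0// => i _; rewrite mxE expr0n.
pose B := \sum_i \sum_j `|M i j|.
exists (n%:R * B) => _ [v /= v1 <-].
have B0 : 0 <= B by rewrite !sumr_ge0// => i _; rewrite sumr_ge0.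
apply: enorm_le_coord => // j; rewrite mxE.
apply: (le_trans (ler_norm_sum _ _ _)).
apply: ler_sum => i _; rewrite normrM.
apply: (@le_trans _ _ (1 * `|M i j|)).
  by rewrite ler_wpM2r// (le_trans _ v1)// coord_le_enorm.
by rewrite mul1r (bigD1 j)//= lerDl sumr_ge0.
Qed.

Lemma entry_le_opnorm M i j : `|M i j| <= opnorm M.
Proof.
have [_ ub] := opnorm_has_sup M.
have H : enorm (delta_mx ord0 i *m M) <= opnorm M.
  apply: ub_le_sup => //; exists (delta_mx ord0 i) => //=.
  rewrite /enorm (bigD1 i)//= big1 ?addr0 => [|k ki].
    by rewrite mxE !eqxx /= expr1n sqrtr1.
  by rewrite mxE (negbTE ki) andbF expr0n.
apply: le_trans H; rewrite -rowE; have := coord_le_enorm (row i M) j.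
by rewrite mxE.
Qed.

Lemma opnorm_ge0 M : 0 <= opnorm M.
Proof.
have [_ ub] := opnorm_has_sup M.
apply: (@le_trans _ _ (enorm (0 *m M))); first exact: enorm_ge0.
apply: ub_le_sup => //; exists 0 => //=.
by rewrite /enorm big1 ?sqrtr0// => i _; rewrite mxE expr0n.
Qed.
End class_F_estimates.

Section class_F_data.
Context {R : realType} {n : nat}.
Variables (Omega : set 'rV[R]_n) (lambda calK : R) (f : 'rV[R]_n -> 'rV[R]_n)
  (Df : 'rV[R]_n -> 'M[R]_n) (K : 'rV[R]_n -> R).
Local Notation leb := (lebesgue_rV R n).
Hypotheses (n2 : (2 <= n)%N) (lambda0 : 0 < lambda) (oO : open Omega)
  (bO : bounded_set Omega) (fdf : finite_distortion Omega f Df K)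
  (det_le : (\int[leb]_(x in Omega) (\det (Df x))%:E <= leb Omega)%E)
  (exp_le : (\int[leb]_(x in Omega) (expR (lambda * K x))%:E <= calK%:E)%E).

Let mO : measurable Omega := open_measurable_rV oO.

Lemma bounded_sub_cube : exists2 r : R, 0 < r & Omega `<=` cube 0 r.
Proof.
have [M [_ HM]] := bO; exists (`|M| + 1); first by rewrite ltr_wpDl.
move=> x Ox.
have /(_ x Ox) : globally Omega [set x | `|x| <= `|M| + 1].
  by apply: HM; rewrite (le_lt_trans (ler_norm M))// ltrDl.
move=> /= /(rV_norm_le _ (_ : 0 <= `|M| + 1)) H i.
by rewrite mxE subr0; apply: H; rewrite addr_ge0.
Qed.

Let mdet : measurable_fun Omega (fun x => \det (Df x)).
Proof. by case: fdf => _ _ ? _ _; exact: L1loc_measurable. Qed.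

Let K1 x : Omega x -> 1 <= K x.
Proof. by case: fdf => _ _ _ [_ H] _; exact: H. Qed.

Let det_ge0 : {ae leb, forall x, Omega x -> 0 <= \det (Df x)}.
Proof.
case: fdf => _ _ _ _; apply: filterS => x H Ox.
have K0 : 0 < K x by exact: lt_le_trans (K1 Ox).
rewrite -(pmulr_rge0 _ K0); apply: le_trans (H Ox).
by rewrite exprn_ge0// opnorm_ge0.
Qed.

(** The distortion inequality forces det >= 0 almost everywhere, so the bound on the integral of det
    is one on that of |det|; it is finite because Omega is bounded. *)
Lemma integrable_abs_det : leb.-integrable Omega (EFin \o (fun x => `|\det (Df x)|)).
Proof.
have mabs : measurable_fun Omega (EFin \o (fun x => `|\det (Df x)|)).
  by apply/measurable_EFinP; exact: measurableT_comp.
apply/integrableP; split=> //.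
have [r r0 Or] := bounded_sub_cube.
have Ofin : (leb Omega < +oo)%E.
  apply: (@le_lt_trans _ _ (leb (cube 0 r))).
    by apply: le_measure => //; rewrite inE//; exact: measurable_cube.
  by rewrite lebesgue_cube ?ltry// ltW.
apply: le_lt_trans Ofin; apply: le_trans det_le.
under eq_integral do rewrite /= normr_id.
rewrite le_eqVlt; apply/orP; left; apply/eqP.
apply: ae_eq_integral => //; first exact/measurable_EFinP.
by apply: filterS det_ge0 => x H Ox; rewrite /= ger0_norm ?H.
Qed.

Lemma integrable_exp_distortion :
  leb.-integrable Omega (EFin \o (fun x => expR (lambda * K x))).
Proof.
have mK : measurable_fun Omega K by case: fdf => _ _ _ [].
have mexp : measurable_fun Omega (EFin \o (fun x => expR (lambda * K x))).
  apply/measurable_EFinP; apply: measurableT_comp => //.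
  by apply: measurable_funM.
apply/integrableP; split=> //.
under eq_integral do rewrite /= ger0_norm ?expR_ge0//.
exact: le_lt_trans exp_le (ltry _).
Qed.

Lemma partial_distortion_le l (sigma s : R) : 0 < sigma -> 0 < s -> 1 <= ln s^-1 ->
  {ae leb, forall x, Omega x -> forall i, `|Df x i l| <=
    sigma * (2 + s * expR (lambda * K x)) +
    2 / lambda * ln s^-1 / sigma ^+ n.-1 * `|\det (Df x)|}.
Proof.
move=> sigma0 s0 s1; case: fdf => _ _ _ _; apply: filterS => x H Ox i.
apply: (le_trans (entry_le_opnorm _ _ _)).
by apply: distortion_young => //; [exact: opnorm_ge0|exact: K1|exact: H].
Qed.

Lemma component_continuous l x : Omega x ->
  {for x, continuous (fun y => f y ord0 l)}.
Proof.
case: fdf => + _ _ _ _ Ox; rewrite continuous_open_subspace// => cf.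
have := cf x (mem_set Ox) => cfx.
exact: (cvg_comp _ _ cfx (@coord_continuous _ _ _ _ _ (f x))).
Qed.

End class_F_data.

Theorem theorem3p10 (R : realType) (n : nat) (lambda calK c0 : R)
    (Omega : set 'rV[R]_n) (x0 : 'rV[R]_n) (f : 'rV[R]_n -> 'rV[R]_n)
    (h : R -> R) :
  (2 <= n)%N -> 0 < lambda -> 0 < calK ->
  uniform_domain_center Omega c0 x0 ->
  class_F lambda calK Omega x0 f ->
  gauge h -> doubling h -> gauge_integrable n h ->
  hausdorff_ae h (boundary Omega) (fun xi =>
    forall (l m : R) (gamma eta : R -> 'rV[R]_n) (a b : 'rV[R]_n),
      boundary_John_curve Omega c0 x0 xi l gamma ->
      boundary_John_curve Omega c0 x0 xi m eta ->
      f (gamma t) @[t --> 0^'+] --> a ->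
      f (eta t) @[t --> 0^'+] --> b ->
      a = b).
Proof.
move=> n2 lambda0 _ [[[_ oO _] bO [c' c'0 uniO]] [_ _ c00 Ox0 _]].
move=> [_ [Df [K [fdf det_le exp_le]]]] hg _ hI.
have mO := open_measurable_rV oO.
pose J x := `|\det (Df x)|.
have iJ := integrable_abs_det oO bO fdf det_le.
have iG := integrable_exp_distortion fdf exp_le.
have [C C1 bC] := @bump_bounded R.
have [r r0 Or] := bounded_sub_cube bO.
(* The radius factor of [scale_nbhd], so that both integrals over neighbourhoods of xi coincide. *)
pose C2 : R := 2 + 2 * n%:R * c'.
have C20 : 0 <= C2 by rewrite addr_ge0// !mulr_ge0// ltW.
have Or1 : closure Omega `<=` cube 0 (r + 1).
  move=> x xO; have [y [Oy xy]] := xO _ (nbhs_cube x ltr01).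
  move=> i; have := Or _ Oy i; have := xy i; rewrite !mxE !subr0.
  by rewrite !ler_norml => /andP[? ?] /andP[? ?]; apply/andP; split; lra.
rewrite /hausdorff_ae.
apply: (slow_energy_null (J := J) (Rb := r + 1) n2 mO _ iJ hg hI C20).
- by move=> x; exact: normr_ge0.
- by rewrite addr_gt0.
- by move=> x [[xO _] _]; exact: Or1.
(* Contrapositive: if no e > 0 bounds ln (1/t) times the local energy from below on (0, e), then
   every e > 0 has some t < e where this product is at most e, and the limits agree. *)
move=> xi [bxi]; apply: contra_notP => noe l m gamma eta a b Jg Je fa fb.
have good (e : R) : 0 < e -> exists2 t : R, 0 < t < e &
    ln t^-1 * \int[lebesgue_rV R n]_(x in scale_nbhd Omega c' t xi) J x <= e.
  move=> e0; apply/not_exists2P => H; apply: noe; exists e => // t te.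
  by case: (H t) => // /negP; rewrite -ltNge.
apply/rowP => i.
have [_ [Lf LWf] _ _ _] := fdf.
apply: (limits_agree (u := fun x => f x ord0 i) (g := fun k x => Df x k i)
  (G := fun x => expR (lambda * K x)) (J := J) n2 oO lambda0 (Lf i) _ _ _ _ iG iJ _ C1 bC
  _ c00 c'0 bxi Ox0 uniO good Jg Je).
- by move=> k; have [] := LWf k i.
- by move=> k; have [] := LWf k i.
- by move=> x; exact: expR_ge0.
- by move=> x; exact: normr_ge0.
- by move=> sigma s ? ? ?; exact: (partial_distortion_le n2 lambda0 fdf).
- by move=> x Ox; exact: (component_continuous oO fdf).
- exact: (cvg_comp _ _ fa (@coord_continuous _ _ _ _ _ a)).
- exact: (cvg_comp _ _ fb (@coord_continuous _ _ _ _ _ b)).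
Qed.
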